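(* Let $A \in \{0,1\}^{m \times n}$ be the incidence matrix of a set system on $n$ elements in which each element lies in at most $k$ sets (every column of $A$ has at most $k$ nonzero entries). If $k = \Omega(\log^2 n)$, then $\mathsf{disc}(A) = O(k^{1/2})$.
   Context: For a matrix $A \in \mathbb{R}^{m\times n}$, $\mathsf{disc}(A) := \min_{x \in \{-1,1\}^n} \|Ax\|_\infty$. *)

(* Defs.v *)
From HB Require Import structures.
From mathcomp Require Import all_boot all_order all_algebra.
From mathcomp Require Import all_classical all_reals all_analysis.
Import Order.TTheory GRing.Theory Num.Theory.
Import numFieldNormedType.Exports.

Set Implicit Arguments.
Unset Strict Implicit.
Unset Printing Implicit Defensive.

Local Open Scope ring_scope.

(* s encodes a point of {-1,1}^n; [true] is sent to -1 *)
Definition sign_vec (R : realType) (n : nat) (s : {ffun 'I_n -> bool}) :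
    'cV[R]_n :=
  \col_(i < n) (-1) ^+ s i.

(* The norm on matrices is the maximum of the absolute values of the entries
   (0 if there are none), i.e. the sup norm for a column vector.  The default
   value of the minimum is itself one of the values being minimised. *)
Definition disc (R : realType) (m n : nat) (A : 'M[R]_(m, n)) : R :=
  \big[Num.min/`|A *m sign_vec R [ffun=> false]|]_(s : {ffun 'I_n -> bool})
    `|A *m sign_vec R s|.

Definition zero_one (R : realType) (m n : nat) (A : 'M[R]_(m, n)) : Prop :=
  forall i j, A i j = 0 \/ A i j = 1.

Definition column_sparse (R : realType) (m n k : nat) (A : 'M[R]_(m, n)) :
    Prop :=
  forall j : 'I_n, (#|[pred i : 'I_m | A i j != 0%R]| <= k)%N.

(* Main.v *)
Require Import Defs.
From HB Require Import structures.
From mathcomp Require Import all_boot all_order all_algebra.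
From mathcomp Require Import all_classical all_reals all_analysis.
From mathcomp Require Import ring lra zify.
Import Order.TTheory GRing.Theory Num.Theory.
Import numFieldNormedType.Exports.

Set Implicit Arguments.
Unset Strict Implicit.
Unset Printing Implicit Defensive.

Local Open Scope ring_scope.

(** Enlarging [k] by a constant factor, let [rho = sqrt k] be large compared
    with [log n].  A point of the cube [[-1,1]^n] is moved from the origin to
    a vertex; a coordinate is frozen when it reaches [1] or [-1].  Rows with
    more than [16 rho^2] alive elements are few and are kept at discrepancy 0,
    rows with fewer than [rho] alive elements can be rounded arbitrarily, and
    each remaining row has a barrier [slack], which is of order [rho^2] at the
    start and stays positive only while the discrepancy is [O(rho)].  The load
    of an element is the sum of [rho^2 / slack^2] over its rows, and the
    potential is the sum of [exp (beta * load)] over the alive elements with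
    [beta] of order [log n]; if it does not grow, every alive element keeps a
    bounded load.  By double counting, the rows whose barrier is tight are then
    only a small fraction of the number of alive elements, and they can be kept
    at a fixed discrepancy too.

    Among the directions orthogonal to these few constraints there is one along
    which the potential does not increase to second order.  The decrease of the
    energy [sum (1 - x_i^2)] of each row raises its slack; on a subspace of small
    codimension this dominates the fluctuation of the discrepancies
    ([spectral_cut] in the space of elements) and also the square of the
    fluctuation of the loads ([spectral_cut] in the space of rows, where the
    trace is [O(beta / rho)] per alive element: this is where
    [k >= C log^2 n] is needed).  So a feasible point of maximal Euclidean norm
    has a new coordinate equal to [1] or [-1]. *)

(** * Linear algebra: Bessel's inequality and subspaces of small codimension *)

(** Induction on the family: subtracting from [g] its projection on the head leaves the coefficients
    on the tail unchanged, by orthogonality, and lowers the squared norm by exactly the head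
    term. *)
Lemma weighted_bessel (R : realFieldType) (I : finType) (V : {set I})
    (D : I -> R) (ws : seq {ffun I -> R}) (g : I -> R) :
  (forall i, i \in V -> 0 < D i) ->
  all (fun w : {ffun I -> R} => 0 < \sum_(i in V) D i * w i ^+ 2) ws ->
  pairwise (fun w w' : {ffun I -> R} =>
    \sum_(i in V) D i * w i * w' i == 0) ws ->
  \sum_(w <- ws) (\sum_(i in V) D i * g i * w i) ^+ 2
                 / (\sum_(i in V) D i * w i ^+ 2)
    <= \sum_(i in V) D i * g i ^+ 2.
Proof.
move=> D_gt0; elim: ws g => [|w ws IH] g /=.
  by rewrite big_nil => _ _; apply: sumr_ge0 => i /D_gt0 /ltW Di; rewrite mulr_ge0 ?sqr_ge0.
move=> /andP[w_gt0 ws_gt0] /andP[/allP w_orth ws_orth].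
rewrite big_cons.
set nw := \sum_(i in V) D i * w i ^+ 2 in w_gt0 *.
set gw := \sum_(i in V) D i * g i * w i.
pose h i := g i - gw / nw * w i.
have h2 : \sum_(i in V) D i * h i ^+ 2
    = \sum_(i in V) D i * g i ^+ 2 - gw ^+ 2 / nw.
  transitivity (\sum_(i in V) (D i * g i ^+ 2 - (gw / nw) *+ 2 * (D i * g i * w i)
      + (gw / nw) ^+ 2 * (D i * w i ^+ 2))).
    by apply: eq_bigr => i _; rewrite /h; ring.
  rewrite big_split sumrB /= -!mulr_sumr -/gw -/nw.
  by field; rewrite gt_eqF.
have := IH h ws_gt0 ws_orth; rewrite h2 lerBrDl; congr (_ + _ <= _).
rewrite !big_seq; apply: eq_bigr => w' /w_orth /eqP ww'.
congr (_ ^+ 2 / _).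
transitivity (\sum_(i in V) (D i * g i * w' i - gw / nw * (D i * w i * w' i))).
  by apply: eq_bigr => i _; rewrite /h; ring.
by rewrite sumrB -mulr_sumr ww' mulr0 subr0.
Qed.

(* A maximal [D]-orthogonal family of vectors on which the form exceeds
   [tau] times the [D]-norm is small by Bessel's inequality, and maximality
   bounds the form on the orthogonal complement. *)
Lemma spectral_cut (R : archiRealFieldType) (I K : finType) (V : {set I})
    (Q : {set K}) (D : I -> R) (g : K -> R) (c : K -> I -> R) (tau : R) :
  (forall i, i \in V -> 0 < D i) -> (forall k, k \in Q -> 0 <= g k) -> 0 < tau ->
  exists ws : seq {ffun I -> R},
    (size ws)%:R * tau
      <= \sum_(k in Q) g k * \sum_(i in V) c k i ^+ 2 / D i /\
    forall v : I -> R,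
      (forall w, w \in ws -> \sum_(i in V) D i * w i * v i = 0) ->
      \sum_(k in Q) g k * (\sum_(i in V) c k i * v i) ^+ 2
        <= tau * \sum_(i in V) D i * v i ^+ 2.
Proof.
move=> D_gt0 g_ge0 tau_gt0.
set T := \sum_(k in Q) _.
pose P (v : I -> R) := \sum_(k in Q) g k * (\sum_(i in V) c k i * v i) ^+ 2.
pose nrm (v : I -> R) := \sum_(i in V) D i * v i ^+ 2.
pose fam (ws : seq {ffun I -> R}) := [&& all (fun w : {ffun I -> R} => 0 < nrm w) ws,
  pairwise (fun w w' : {ffun I -> R} => \sum_(i in V) D i * w i * w' i == 0) ws &
  all (fun w : {ffun I -> R} => tau * nrm w <= P w) ws].
(* Bessel is applied to each [c k / D], whose squared [D]-norm is the inner sum of the [k]-th term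
   of [T]; each member of the family contributes at least [tau]. *)
have famT ws : fam ws -> (size ws)%:R * tau <= T.
  case/and3P=> ws_gt0 ws_orth /allP ws_big.
  have bes k : k \in Q -> \sum_(w <- ws) (\sum_(i in V) c k i * w i) ^+ 2 / nrm w
      <= \sum_(i in V) c k i ^+ 2 / D i.
    move=> kQ.
    have := @weighted_bessel _ _ V D ws (fun i => c k i / D i) D_gt0 ws_gt0 ws_orth.
    have -> : \sum_(i in V) D i * (c k i / D i) ^+ 2 = \sum_(i in V) c k i ^+ 2 / D i.
      by apply: eq_bigr => i /D_gt0 Di; field; rewrite gt_eqF.
    apply: le_trans; rewrite le_eqVlt; apply/orP; left; apply/eqP.
    apply: eq_bigr => w _; congr (_ ^+ 2 / _); apply: eq_bigr => i /D_gt0 Di.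
    by field; rewrite gt_eqF.
  have : \sum_(w <- ws) P w / nrm w <= T.
    have -> : \sum_(w <- ws) P w / nrm w =
        \sum_(k in Q) g k * \sum_(w <- ws) (\sum_(i in V) c k i * w i) ^+ 2 / nrm w.
      under eq_bigr do rewrite /P mulr_suml.
      rewrite exchange_big /=; apply: eq_bigr => k _.
      by rewrite mulr_sumr; apply: eq_bigr => w _; rewrite mulrA.
    by apply: ler_sum => k kQ; rewrite ler_wpM2l ?g_ge0 ?bes.
  apply: le_trans.
  have -> : (size ws)%:R * tau = \sum_(w <- ws) tau.
    by rewrite big_const_seq count_predT iter_addr_0 mulr_natl.
  rewrite !big_seq; apply: ler_sum => w wws.
  by rewrite ler_pdivlMr ?(allP ws_gt0) ?ws_big.
(* Greedy extension: either the family reaches length [l], or the form is already bounded on its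
   orthogonal complement. *)
have ext l : exists ws, fam ws /\ ((size ws = l) \/
    forall v : I -> R, (forall w, w \in ws -> \sum_(i in V) D i * w i * v i = 0) ->
      P v <= tau * nrm v).
  elim: l => [|l [ws [fws]]]; first by exists [::]; split => //; left.
  case=> [sz|good]; last by exists ws; split => //; right.
  have [good|] := pselect (forall v : I -> R,
      (forall w, w \in ws -> \sum_(i in V) D i * w i * v i = 0) -> P v <= tau * nrm v).
    by exists ws; split => //; right.
  move=> /existsNP[v /not_implyP[v_orth /negP]]; rewrite -ltNge => v_big.
  pose w0 := [ffun i => v i].
  have Pw0 : P w0 = P v.
    by apply: eq_bigr => k _; congr (_ * _ ^+ 2); apply: eq_bigr => i _; rewrite ffunE.
  have nw0 : nrm w0 = nrm v by apply: eq_bigr => i _; rewrite ffunE.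
  have nv_ge0 : 0 <= nrm v by apply: sumr_ge0 => i /D_gt0 /ltW Di; rewrite mulr_ge0 ?sqr_ge0.
  have nv_gt0 : 0 < nrm v.
    rewrite lt_neqAle nv_ge0 andbT eq_sym; apply/negP => /eqP nv0.
    have v0 i : i \in V -> v i = 0.
      move=> iV; have /psumr_eq0P/(_ i iV)/eqP := nv0.
      rewrite mulf_eq0 gt_eqF ?D_gt0//= sqrf_eq0 => h; apply/eqP; apply: h.
      by move=> j /D_gt0 /ltW Di; rewrite mulr_ge0 ?sqr_ge0.
    move: v_big; rewrite nv0 mulr0 /P big1 ?ltxx// => k _.
    by rewrite big1 ?expr0n ?mulr0// => i /v0 ->; rewrite mulr0.
  case/and3P: fws => f1 f2 f3.
  exists (w0 :: ws); split; last by left; rewrite /= sz.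
  apply/and3P; split => /=; rewrite ?nw0 ?nv_gt0 ?f1 ?f2 ?f3 ?Pw0 ?(ltW v_big) ?andbT//.
  apply/allP => w /v_orth h; apply/eqP; rewrite -[RHS]h; apply: eq_bigr => i _.
  by rewrite ffunE; ring.
have [l Tl] : exists l : nat, T < l%:R * tau.
  exists (Num.bound (T / tau)); rewrite -ltr_pdivrMr//.
  have T_ge0 : 0 <= T / tau.
    rewrite divr_ge0 ?(ltW tau_gt0)//; apply: sumr_ge0 => k /g_ge0 gk.
    by rewrite mulr_ge0//; apply: sumr_ge0 => i /D_gt0 /ltW Di; rewrite divr_ge0 ?sqr_ge0.
  exact: archi_boundP.
have [ws [fws [szl|good]]] := ext l; last by exists ws; split; [exact: famT | exact: good].
by move: (famT _ fws); rewrite szl leNgt Tl.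
Qed.

Lemma kernel_vector (F : fieldType) (I : finType) (V : {set I})
    (cs : seq {ffun I -> F}) :
  (size cs < #|V|)%N ->
  exists v : I -> F, [/\ exists i, v i != 0, forall i, i \notin V -> v i = 0 &
    forall c, c \in cs -> \sum_(i in V) c i * v i = 0].
Proof.
move=> ltV.
pose M : 'M[F]_(#|V|, size cs) := \matrix_(p, q) tnth (in_tuple cs) q (enum_val p).
have : kermx M != 0.
  by rewrite kermx_eq0 /row_free neq_ltn (leq_ltn_trans (rank_leq_col _)).
move=> /rowV0Pn[r /sub_kermxP rM r_neq0].
have [i0 i0V] : exists i0, i0 \in V.
  by apply/card_gt0P; exact: leq_ltn_trans ltV.
exists (fun i => if i \in V then r 0 (enum_rank_in i0V i) else 0); split.
- have [p rp] : exists p, r 0 p != 0.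
    apply/existsP; apply: contraNT r_neq0; rewrite negb_exists => /forallP r0.
    by apply/eqP/rowP => p; rewrite mxE; apply/eqP; have := r0 p; rewrite negbK.
  by exists (enum_val p); rewrite enum_valP enum_valK_in.
- by move=> i /negbTE ->.
- move=> c ccs.
  have /tnthP[q ->] : c \in in_tuple cs by [].
  have := congr1 (fun N : 'rV_(size cs) => N 0 q) rM; rewrite !mxE => rMq.
  rewrite -[RHS]rMq big_enum_val; apply: eq_bigr => p _.
  by rewrite enum_valP enum_valK_in mulrC mxE.
Qed.

Lemma sum_div_le_card (R : realFieldType) (I : finType) (V : {set I}) (f D : I -> R) :
  (forall i, i \in V -> 0 < D i) -> (forall i, i \in V -> f i <= D i) ->
  \sum_(i in V) f i / D i <= #|V|%:R.
Proof.
move=> D_gt0 fD; rewrite -sum1_card natr_sum; apply: ler_sum => i iV.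
by rewrite ler_pdivrMr ?D_gt0// mul1r fD.
Qed.

(** Two cuts are made in the space of elements, with threshold 8 against a trace of at most [#|V|],
    and one in the space of rows, with threshold 1 against a trace of at most [#|V| / 8]. Each costs
    at most [#|V| / 8] linear constraints. *)
Lemma direction_exists (R : archiRealFieldType) (I J : finType) (V : {set I})
    (Q B T : {set J}) (a : J -> I -> R) (x : I -> R) (km : J -> R) (D : I -> R)
    (bc : J -> I -> R) (h : J -> R) (g : I -> R) (e : J -> I -> R) :
  (forall j i, a j i = 0 \/ a j i = 1) ->
  (forall i, x i ^+ 2 <= 1) ->
  (forall i, i \in V -> 0 < D i) ->
  (forall j, j \in Q -> 0 <= km j) ->
  (forall i, i \in V -> \sum_(j in Q) km j * a j i <= D i) ->
  (forall j, j \in Q -> 0 < h j) ->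
  (forall i, i \in V -> 0 <= g i) ->
  \sum_(i in V) g i * (\sum_(j in Q) e j i ^+ 2 / h j) * 8 <= #|V|%:R ->
  (#|B| * 16 <= #|V|)%N -> (#|T| * 40 <= #|V|)%N -> (2 <= #|V|)%N ->
  exists v : I -> R, [/\ exists i, v i != 0, forall i, i \notin V -> v i = 0,
      \sum_(i in V) x i * v i = 0,
      forall j, j \in B -> \sum_(i in V) a j i * v i = 0 &
      forall j, j \in T -> \sum_(i in V) a j i * v i = 0 /\
                           \sum_(i in V) a j i * x i * v i = 0] /\
    [/\ \sum_(j in Q) km j * (\sum_(i in V) a j i * v i) ^+ 2
          <= 8 * \sum_(i in V) D i * v i ^+ 2,
        \sum_(j in Q) km j * (\sum_(i in V) a j i * x i * v i) ^+ 2
          <= 8 * \sum_(i in V) D i * v i ^+ 2 &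
        \sum_(i in V) g i * (\sum_(j in Q) e j i * \sum_(l in V) bc j l * v l) ^+ 2
          <= \sum_(j in Q) h j * (\sum_(l in V) bc j l * v l) ^+ 2].
Proof.
move=> a01 x1 D_gt0 km_ge0 kmD h_gt0 g_ge0 tr cB cT V2.
have a2 j i : a j i ^+ 2 = a j i by case: (a01 j i) => ->; rewrite ?expr0n ?expr1n.
have a_ge0 j i : 0 <= a j i by case: (a01 j i) => ->.
have trace (c : J -> I -> R) : (forall j i, c j i ^+ 2 <= a j i) ->
    \sum_(j in Q) km j * (\sum_(i in V) c j i ^+ 2 / D i) <= #|V|%:R.
  move=> ca; apply: le_trans (sum_div_le_card D_gt0 kmD).
  under [leLHS]eq_bigr do rewrite mulr_sumr.
  rewrite exchange_big; apply: ler_sum => i iV; rewrite mulr_suml.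
  apply: ler_sum => j jQ; rewrite mulrA.
  by rewrite ler_wpM2r ?invr_ge0 ?(ltW (D_gt0 _ iV))// ler_wpM2l ?km_ge0.
have [|ws1 [sz1 ok1]] := @spectral_cut R I J V Q D km a 8 D_gt0 km_ge0.
- by [].
have [|ws2 [sz2 ok2]] :=
    @spectral_cut R I J V Q D km (fun j i => a j i * x i) 8 D_gt0 km_ge0.
- by [].
have [|ws3 [sz3 ok3]] := @spectral_cut R J I Q V h g (fun i j => e j i) 1 h_gt0 g_ge0.
- by [].
have {}sz1 : (size ws1 * 8 <= #|V|)%N.
  rewrite -(ler_nat R) natrM; apply: (le_trans sz1); apply: trace => j i.
  by rewrite a2.
have {}sz2 : (size ws2 * 8 <= #|V|)%N.
  rewrite -(ler_nat R) natrM; apply: (le_trans sz2); apply: trace => j i.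
  by rewrite exprMn a2 ler_piMr.
have {}sz3 : (size ws3 * 8 <= #|V|)%N.
  rewrite -(ler_nat R) natrM; apply: le_trans tr.
  by rewrite -mulr_suml ler_wpM2r// (le_trans _ sz3)// mulr1.
pose row j : {ffun I -> R} := [ffun i => a j i].
pose rowx j : {ffun I -> R} := [ffun i => a j i * x i].
(* Orthogonality in the weighted inner products is rewritten as plain linear constraints on [v]; a
   constraint in the space of rows is pulled back to the elements through [bc]. *)
pose lift_D (w : {ffun I -> R}) : {ffun I -> R} := [ffun i => D i * w i].
pose lift_h (w : {ffun J -> R}) : {ffun I -> R} :=
  [ffun i => \sum_(j in Q) h j * w j * bc j i].
pose cs : seq {ffun I -> R} := [ffun i => x i] :: map row (enum B) ++ map row (enum T)
  ++ map rowx (enum T) ++ map lift_D ws1 ++ map lift_D ws2 ++ map lift_h ws3.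
(* There are at most [1 + (1/16 + 2/40 + 3/8) * #|V|] constraints, fewer than [#|V|] as soon as
   [#|V|] is at least 2. *)
have [|v [v_neq0 v_off v_cs]] := @kernel_vector R I V cs.
  rewrite /cs /= !size_cat !size_map -!cardE; lia.
have v_in (c : {ffun I -> R}) f : c \in cs -> (forall i, c i = f i) ->
    \sum_(i in V) f i * v i = 0.
  by move=> ccs cf; rewrite -[RHS](v_cs _ ccs); apply: eq_bigr => i _; rewrite cf.
exists v; split; split => //.
- by apply: (v_in [ffun i => x i]) => [|i]; rewrite ?mem_head ?ffunE.
- move=> j jB; apply: (v_in (row j)) => [|i]; last by rewrite ffunE.
  by rewrite inE !mem_cat (map_f row (_ : j \in enum B)) ?mem_enum ?orbT.
- move=> j jT; split.
    apply: (v_in (row j)) => [|i]; last by rewrite ffunE.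
    by rewrite inE !mem_cat (map_f row (_ : j \in enum T)) ?mem_enum ?orbT.
  apply: (v_in (rowx j)) => [|i]; last by rewrite ffunE.
  by rewrite inE !mem_cat (map_f rowx (_ : j \in enum T)) ?mem_enum ?orbT.
- apply: ok1 => w wws; apply: (v_in (lift_D w)) => [|i]; last by rewrite ffunE.
  by rewrite inE !mem_cat (map_f lift_D wws) ?orbT.
- apply: ok2 => w wws; apply: (v_in (lift_D w)) => [|i]; last by rewrite ffunE.
  by rewrite inE !mem_cat (map_f lift_D wws) ?orbT.
- rewrite -[leRHS]mul1r; apply: (ok3 (fun j => \sum_(l in V) bc j l * v l)) => w wws.
  rewrite -[RHS](v_in (lift_h w) (fun i => \sum_(j in Q) h j * w j * bc j i)).
  + under eq_bigr do rewrite mulr_sumr.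
    rewrite exchange_big; apply: eq_bigr => i _; rewrite mulr_suml.
    by apply: eq_bigr => j _; rewrite mulrA.
  + by rewrite inE !mem_cat (map_f lift_h wws) ?orbT.
  + by move=> i; rewrite ffunE.
Qed.

(** * The second-order change of the potential *)

(** The squared derivative of the slack is split by [(p - q)^2 <= 2 p^2 + 2 q^2]. The bounds on [u]
    and [d] turn the two halves into [2304 lam kap al^2] and [9 kap xi^2 / sg^2], and [sg <= 4 rho]
    gives [kap >= 1/64], which absorbs the last term on the left. *)
Lemma row_second_order (R : realFieldType) (rho lam sg u d al xi m kap : R) :
  0 < lam -> lam * 1000 * 1000 <= 1 -> 400 <= rho -> 0 < sg -> rho <= sg ^+ 2 -> sg <= 4 * rho ->
  rho * sg / 18 <= u -> lam * d ^+ 2 <= rho ^+ 2 -> 0 <= m ->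
  kap = rho / (16 * sg) ->
  5 * (m / u * (2 * kap * xi - 2 * lam * d * al) ^+ 2) + 2 * lam * (m * al ^+ 2)
    <= 12 * 1000 * lam * (kap * m * al ^+ 2) + 45 / rho * (kap * m * xi ^+ 2).
Proof.
move=> lam0 lam1 rho400 sg0 sgrho sg4 ule dle m0 kapE.
have rho0 : 0 < rho by lra.
have u0 : 0 < u by apply: lt_le_trans ule; rewrite divr_gt0 ?mulr_gt0.
have kap0 : 0 < kap by rewrite kapE divr_gt0 ?mulr_gt0.
have kapl : 1 / 64 <= kap.
  by rewrite kapE ler_pdivlMr ?mulr_gt0//; lra.
have iu : u^-1 <= 18 / (rho * sg).
  have -> : 18 / (rho * sg) = (rho * sg / 18)^-1 by field; rewrite !gt_eqF.
  by rewrite lef_pV2 ?posrE// divr_gt0 ?mulr_gt0.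
have bsq : (2 * kap * xi - 2 * lam * d * al) ^+ 2
    <= 8 * (lam * rho ^+ 2 * al ^+ 2 + kap ^+ 2 * xi ^+ 2).
  have : lam * (lam * d ^+ 2) * al ^+ 2 <= lam * rho ^+ 2 * al ^+ 2.
    by rewrite ler_wpM2r ?sqr_ge0// ler_wpM2l// ltW.
  have : 0 <= (2 * kap * xi + 2 * lam * d * al) ^+ 2 := sqr_ge0 _.
  by lra.
have bu : u^-1 * (2 * kap * xi - 2 * lam * d * al) ^+ 2
    <= 18 / (rho * sg) * (8 * (lam * rho ^+ 2 * al ^+ 2 + kap ^+ 2 * xi ^+ 2)).
  by apply: ler_pM => //; rewrite ?invr_ge0 ?sqr_ge0// ltW.
have E1 : 18 / (rho * sg) * (8 * (lam * rho ^+ 2 * al ^+ 2 + kap ^+ 2 * xi ^+ 2))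
   = 2304 * lam * (kap * al ^+ 2) + 9 * (sg ^+ 2)^-1 * (kap * xi ^+ 2).
  by rewrite kapE; field; rewrite !gt_eqF.
have E2 : (sg ^+ 2)^-1 * (kap * xi ^+ 2) <= rho^-1 * (kap * xi ^+ 2).
  apply: ler_wpM2r; first by rewrite mulr_ge0 ?sqr_ge0 ?(ltW kap0).
  by rewrite lef_pV2 // posrE exprn_gt0.
have E3 : lam * al ^+ 2 <= 64 * lam * (kap * al ^+ 2).
  move: (ler_wpM2l (mulr_ge0 (ltW lam0) (sqr_ge0 al)) kapl); clear; lra.
have E4 : 0 <= lam * (kap * al ^+ 2) by rewrite mulr_ge0 ?(ltW lam0)// mulr_ge0 ?sqr_ge0 ?(ltW kap0).
have F : 5 * (u^-1 * (2 * kap * xi - 2 * lam * d * al) ^+ 2) + 2 * (lam * al ^+ 2)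
    <= 12 * 1000 * lam * (kap * al ^+ 2) + 45 / rho * (kap * xi ^+ 2).
  move: bu E2 E3 E4; rewrite E1; clear; lra.
move: (ler_wpM2l m0 F); clear; lra.
Qed.

(** Here [b] and [q] are the coefficients of the slacks along [v], and [w1], [w2] those of the
    loads. The only negative contribution is [- 2 * N0], the gain from the energy; the spectral cuts
    bound all the others by multiples of [Nv], which exceeds [N0] only by the regularizing term of
    [D]. *)
Lemma second_order_bound (R : realType) (I J : finType) (V : {set I}) (Q : {set J})
    (a : J -> I -> R) (x v E : I -> R) (u d sg m kap D w1 w2 : _) (rho lam beta : R)
    (al := fun j => \sum_(i in V) a j i * v i)
    (xi := fun j => \sum_(i in V) a j i * x i * v i)
    (b := fun j => 2 * kap j * xi j - 2 * lam * d j * al j)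
    (q := fun j => kap j * (\sum_(i in V) a j i * v i ^+ 2) - lam * al j ^+ 2) :
  0 < lam -> lam * 1000 * 1000 <= 1 -> 400 <= rho -> 0 < beta ->
  (forall j i, 0 <= a j i) -> (forall i, i \in V -> 0 < E i) ->
  (exists i, v i != 0) -> (forall i, i \notin V -> v i = 0) ->
  (forall j, j \in Q -> [/\ 0 < sg j, rho <= sg j ^+ 2, sg j <= 4 * rho,
      rho * sg j / 18 <= u j & lam * d j ^+ 2 <= rho ^+ 2]) ->
  (forall j, kap j = rho / (16 * sg j)) ->
  (forall j, m j = (\sum_(i in V) E i * a j i) / u j ^+ 3) ->
  (forall i, D i = \sum_(j in Q) kap j * m j * a j i + (2 * beta * rho ^+ 2)^-1) ->
  (forall i, w1 i = - (2 * rho ^+ 2 * \sum_(j in Q) a j i / u j ^+ 3 * b j)) ->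
  (forall i, w2 i = rho ^+ 2 * \sum_(j in Q)
      a j i * (4 * b j ^+ 2 / u j ^+ 4 - 2 * q j / u j ^+ 3)) ->
  \sum_(j in Q) kap j * m j * al j ^+ 2 <= 8 * \sum_(i in V) D i * v i ^+ 2 ->
  \sum_(j in Q) kap j * m j * xi j ^+ 2 <= 8 * \sum_(i in V) D i * v i ^+ 2 ->
  \sum_(i in V) 8 * beta * rho ^+ 2 * E i * (\sum_(j in Q) a j i / u j ^+ 3 * b j) ^+ 2
    <= \sum_(j in Q) m j / u j * b j ^+ 2 ->
  \sum_(i in V) E i * (beta * w2 i + 2 * beta ^+ 2 * w1 i ^+ 2) < \sum_(i in V) v i ^+ 2.
Proof.
move=> lam0 lam1 rho400 beta0 a_ge0 E0 [i0 vi0] v_off Qok kapE mE DE w1E w2E.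
set Nv := \sum_(i in V) D i * v i ^+ 2.
set Y := \sum_(j in Q) m j / u j * b j ^+ 2.
set R' := \sum_(i in V) _ * _.
move=> P1 P2 PR.
have rho0 : 0 < rho by lra.
have u0 j : j \in Q -> 0 < u j.
  by case/Qok => sg0 _ _ + _; apply: lt_le_trans; rewrite divr_gt0 ?mulr_gt0.
have m0 j : j \in Q -> 0 <= m j.
  move=> jQ; rewrite mE divr_ge0 ?exprn_ge0 ?(ltW (u0 _ jQ))//.
  by apply: sumr_ge0 => i /E0 /ltW Ei; rewrite mulr_ge0.
have kap0 j : j \in Q -> 0 <= kap j.
  by case/Qok => sg0 _ _ _ _; rewrite kapE divr_ge0 ?mulr_ge0 ?(ltW rho0) ?(ltW sg0).
pose v2 := \sum_(i in V) v i ^+ 2.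
pose N0 := \sum_(i in V) (\sum_(j in Q) kap j * m j * a j i) * v i ^+ 2.
pose A2 := \sum_(j in Q) m j * al j ^+ 2.
have v2_gt0 : 0 < v2.
  have i0V : i0 \in V by apply: contraNT vi0 => /v_off ->.
  rewrite /v2 (bigD1 i0)//=; apply: ltr_pwDl; first by rewrite exprn_even_gt0.
  by apply: sumr_ge0 => i _; exact: sqr_ge0.
have N0_ge0 : 0 <= N0.
  apply: sumr_ge0 => i _; rewrite mulr_ge0 ?sqr_ge0//; apply: sumr_ge0 => j jQ.
  by rewrite !mulr_ge0 ?kap0 ?m0.
have NvE : Nv = N0 + (2 * beta * rho ^+ 2)^-1 * v2.
  rewrite /Nv /N0 /v2 mulr_sumr -big_split; apply: eq_bigr => i _.
  by rewrite DE mulrDl.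
have N0E : N0 = \sum_(j in Q) kap j * m j * \sum_(i in V) a j i * v i ^+ 2.
  rewrite /N0; under eq_bigr do rewrite mulr_suml.
  rewrite exchange_big; apply: eq_bigr => j _; rewrite mulr_sumr.
  by apply: eq_bigr => i _; rewrite mulrA.
have S1 : \sum_(i in V) E i * (beta * w2 i + 2 * beta ^+ 2 * w1 i ^+ 2)
    = beta * rho ^+ 2 * (4 * Y - 2 * N0 + 2 * lam * A2 + R').
  transitivity (beta * rho ^+ 2 * (\sum_(i in V) E i * \sum_(j in Q)
      a j i * (4 * b j ^+ 2 / u j ^+ 4 - 2 * q j / u j ^+ 3) + R')).
    rewrite /R' -big_split mulr_sumr; apply: eq_bigr => i _.
    by rewrite w1E w2E /=; ring.
  congr (_ * (_ + _)).
  transitivity (\sum_(j in Q) (4 * (m j / u j * b j ^+ 2)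
      - 2 * (kap j * m j * \sum_(i in V) a j i * v i ^+ 2)
      + 2 * lam * (m j * al j ^+ 2))); last first.
    by rewrite big_split sumrB /= -!mulr_sumr N0E.
  under eq_bigr do rewrite mulr_sumr.
  rewrite exchange_big; apply: eq_bigr => j jQ /=.
  transitivity (m j * u j ^+ 3 * (4 * b j ^+ 2 / u j ^+ 4 - 2 * q j / u j ^+ 3)).
    rewrite mE divfK ?expf_neq0 ?gt_eqF ?u0// mulr_suml.
    by apply: eq_bigr => i _; rewrite mulrA.
  by rewrite /q; field; rewrite gt_eqF ?u0.
have S2 : 5 * Y + 2 * lam * A2 <= 12 * 1000 * lam * (8 * Nv) + 45 / rho * (8 * Nv).
  have c1 : 0 <= 12 * 1000 * lam by move: lam0; clear; lra.
  have c2 : 0 <= 45 / rho by rewrite divr_ge0 ?(ltW rho0).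
  apply: le_trans (lerD (ler_wpM2l c1 P1) (ler_wpM2l c2 P2)).
  rewrite /Y /A2 !mulr_sumr -!big_split; apply: ler_sum => j jQ.
  have [sg0 sgl sgu ul dl] := Qok j jQ.
  exact: row_second_order (m0 j jQ) (kapE j).
have irho : 45 / rho <= 45 / 400.
  rewrite ler_pdivrMr// mulrAC ler_pdivlMr; move: rho400; clear; lra.
have Nv0 : 0 <= Nv.
  by rewrite NvE addr_ge0// mulr_ge0 ?(ltW v2_gt0)// invr_ge0 mulr_ge0 ?sqr_ge0// mulr_ge0 ?(ltW beta0).
have R'Y : R' <= Y := PR.
clear - S2 R'Y irho Nv0 NvE N0_ge0 v2_gt0 lam1 beta0 rho0 S1.
(* The third cut replaces [R'] by [Y], and [S2] then costs at most [(96/1000 + 360/400) Nv], less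
   than [Nv]. What remains is the regularizing term, worth half of the squared norm of [v]. *)
have S3 : 4 * Y - 2 * N0 + 2 * lam * A2 + R' <= (2 * beta * rho ^+ 2)^-1 * v2.
  have h1 : 12 * 1000 * lam * (8 * Nv) <= 96 / 1000 * Nv.
    move: (ler_wpM2r Nv0 lam1); clear; lra.
  have h2 : 45 / rho * (8 * Nv) <= 45 / 400 * (8 * Nv).
    by rewrite ler_wpM2r ?mulr_ge0.
  have -> : (2 * beta * rho ^+ 2)^-1 * v2 = Nv - N0 by rewrite NvE addrAC subrr add0r.
  move: h1 h2 S2 R'Y Nv0 N0_ge0; clear.
  move: (12 * 1000 * lam * (8 * Nv)) (45 / rho * (8 * Nv)) (2 * lam * A2) => p1 p2 p3.
  move: Nv N0 Y R' => Nv N0 Y R'; lra.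
rewrite S1 -/v2.
have br : 0 < beta * rho ^+ 2 by rewrite mulr_gt0 ?exprn_gt0.
apply: le_lt_trans (ler_wpM2l (ltW br) S3) _.
have -> : beta * rho ^+ 2 * ((2 * beta * rho ^+ 2)^-1 * v2) = v2 / 2.
  by field; rewrite !gt_eqF.
by rewrite ltr_pdivrMr// ltr_pMr// ltr1n.
Qed.

(** * One-sided second-order expansions *)

(** [expR (- y) >= 1 - y] is inverted, and [(1 - y) (1 + y + 2 y^2) = 1 + y^2 (1 - 2 y)]. *)
Lemma expR_le_quadratic (R : realType) (y : R) :
  `|y| <= 1 / 2 -> expR y <= 1 + y + 2 * y ^+ 2.
Proof.
rewrite ler_norml => /andP[y1 y2].
have e1 : 1 - y <= expR (- y) := expR_ge1Dx (- y).
have p1 : 0 < 1 - y by lra.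
rewrite -[y in expR y]opprK expRN.
apply: (@le_trans _ _ (1 - y)^-1); first by rewrite lef_pV2 ?posrE ?expR_gt0.
rewrite -[leLHS]mul1r ler_pdivrMr//.
have h1 : 0 <= 1 - 2 * y by lra.
have := mulr_ge0 (sqr_ge0 y) h1; lra.
Qed.

(** A one-sided Taylor expansion at 0: the coefficients may overestimate the true ones, so
    elementary inequalities replace derivatives. *)
Definition upper_jet (R : realType) (f : R -> R) (a b c : R) : Prop :=
  exists C tau : R, [/\ 0 <= C, 0 < tau &
    forall t, `|t| <= tau -> f t <= a + b * t + c * t ^+ 2 + C * `|t| ^+ 3].

Lemma upper_jet_poly (R : realType) (a b c : R) :
  upper_jet (fun t => a + b * t + c * t ^+ 2) a b c.
Proof. by exists 0, 1; split => // t _; rewrite mul0r addr0. Qed.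

Lemma upper_jetD (R : realType) (f g : R -> R) (a b c a' b' c' : R) :
  upper_jet f a b c -> upper_jet g a' b' c' ->
  upper_jet (fun t => f t + g t) (a + a') (b + b') (c + c').
Proof.
move=> [C [tau [C0 tau0 fP]]] [C' [tau' [C'0 tau'0 gP]]].
exists (C + C'), (Num.min tau tau'); split; rewrite ?addr_ge0 ?lt_min ?tau0//.
move=> t; rewrite le_min => /andP[t1 t2].
have := lerD (fP t t1) (gP t t2); lra.
Qed.

Lemma upper_jetZ (R : realType) (k : R) (f : R -> R) (a b c : R) : 0 <= k ->
  upper_jet f a b c -> upper_jet (fun t => k * f t) (k * a) (k * b) (k * c).
Proof.
move=> k0 [C [tau [C0 tau0 fP]]]; exists (k * C), tau; split; rewrite ?mulr_ge0//.
move=> t /fP /(ler_wpM2l k0); lra.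
Qed.

Lemma upper_jet_sum (R : realType) (I : finType) (V : {set I}) (f : I -> R -> R)
    (a b c : I -> R) :
  (forall i, i \in V -> upper_jet (f i) (a i) (b i) (c i)) ->
  upper_jet (fun t => \sum_(i in V) f i t)
    (\sum_(i in V) a i) (\sum_(i in V) b i) (\sum_(i in V) c i).
Proof.
move=> fP; rewrite unlock; elim: index_enum => [|i s IH] /=.
  by exists 0, 1; split => // t _; rewrite !mul0r !addr0.
by case: (boolP (i \in V)) => [/fP/upper_jetD|]; first exact.
Qed.

(** The exact second-order coefficient has [3 b^2]; the larger [4 b^2] absorbs the tail of the
    expansion of [(1 + r)^-2]. *)
Lemma upper_jet_invsq (R : realType) (u b q : R) : 0 < u ->
  upper_jet (fun t => ((u + b * t + q * t ^+ 2) ^+ 2)^-1)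
    (u ^+ 2)^-1 (- (2 * b / u ^+ 3)) (4 * b ^+ 2 / u ^+ 4 - 2 * q / u ^+ 3).
Proof.
move=> u0; set K := `|b| + `|q| + 1.
have K0 : 0 < K by rewrite ltr_wpDl ?addr_ge0.
exists ((8 * `|b * q| + 4 * q ^+ 2) / u ^+ 4), (Num.min 1 (u / (8 * K))).
split.
- apply: divr_ge0; last by rewrite exprn_ge0 ?(ltW u0).
  by apply: addr_ge0; rewrite mulr_ge0 ?sqr_ge0.
- by rewrite lt_min ltr01 divr_gt0 ?mulr_gt0.
move=> t; rewrite le_min => /andP[t1]; rewrite ler_pdivlMr ?mulr_gt0// => tu.
set s := `|t| in t1 tu *.
have s0 : 0 <= s by exact: normr_ge0.
have ts : t ^+ 2 = s ^+ 2 by rewrite real_normK ?num_real.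
set r := (b * t + q * t ^+ 2) / u.
have rb : `|r| <= 1 / 8.
  rewrite normrM [X in _ * X]gtr0_norm ?invr_gt0// ler_pdivrMr//.
  apply: (le_trans (ler_normD _ _)); rewrite (normrM b) (normrM q) -/s.
  rewrite [`|t ^+ 2|]ger0_norm ?sqr_ge0// ts.
  have : `|q| * s ^+ 2 <= `|q| * s by rewrite ler_wpM2l// expr2 ler_piMl.
  rewrite /K in tu; lra.
have -> : u + b * t + q * t ^+ 2 = u * (1 + r) by rewrite /r; field; rewrite gt_eqF.
have r1 : 1 / 2 <= 1 + r by move: rb; rewrite ler_norml => /andP[? ?]; lra.
have r1p : 0 < 1 + r by lra.
(* [(1 + r)^2 (1 - 2 r + 4 r^2) = 1 + r^2 (1 + 6 r + 4 r^2)], and the last factor is positive for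
   [|r| <= 1/8]. *)
have inv_le : ((1 + r) ^+ 2)^-1 <= 1 - 2 * r + 4 * r ^+ 2.
  rewrite -[leLHS]mul1r ler_pdivrMr ?exprn_gt0//.
  have h : 0 <= 1 + 6 * r + 4 * r ^+ 2.
    by have := sqr_ge0 r; move: rb; rewrite ler_norml => /andP[? ?]; lra.
  have := mulr_ge0 (sqr_ge0 r) h; lra.
rewrite exprMn invfM.
have iu : 0 <= (u ^+ 2)^-1 by rewrite invr_ge0 sqr_ge0.
apply: (le_trans (ler_wpM2l iu inv_le)).
have cross : b * t * (q * t ^+ 2) <= `|b * q| * s ^+ 3.
  apply: (le_trans (ler_norm _)).
  rewrite 2!normrM (normrM q) -/s [`|t ^+ 2|]ger0_norm ?sqr_ge0// ts normrM.
  by rewrite le_eqVlt; apply/orP; left; apply/eqP; ring.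
have quart : q ^+ 2 * t ^+ 4 <= q ^+ 2 * s ^+ 3.
  have -> : t ^+ 4 = s ^+ 3 * s.
    by have -> : t ^+ 4 = t ^+ 2 * t ^+ 2; [ring | rewrite ts; ring].
  by rewrite ler_wpM2l ?sqr_ge0// ler_piMr// exprn_ge0.
have -> : (u ^+ 2)^-1 * (1 - 2 * r + 4 * r ^+ 2) =
  (u ^+ 2)^-1 + - (2 * b / u ^+ 3) * t + (4 * b ^+ 2 / u ^+ 4 - 2 * q / u ^+ 3) * t ^+ 2
  + (8 * (b * t * (q * t ^+ 2)) + 4 * (q ^+ 2 * t ^+ 4)) / u ^+ 4.
  by rewrite /r; field; rewrite gt_eqF.
rewrite lerD2l [leRHS]mulrAC; apply: ler_wpM2r.
  by rewrite invr_ge0 exprn_ge0 ?(ltW u0).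
move: cross quart; clear; lra.
Qed.

Lemma upper_jet_expR (R : realType) (k : R) (f : R -> R) (a b c : R) : 0 <= k ->
  upper_jet f a b c ->
  upper_jet (fun t => expR (k * f t)) (expR (k * a)) (expR (k * a) * (k * b))
    (expR (k * a) * (k * c + 2 * k ^+ 2 * b ^+ 2)).
Proof.
move=> k0 [C [tau [C0 tau0 fP]]].
set K := `|c| + C; have K0 : 0 <= K by rewrite addr_ge0.
set L := k * (`|b| + K) + 1; have L0 : 0 < L by rewrite ltr_wpDl ?mulr_ge0 ?addr_ge0.
exists (expR (k * a) * (k * C + 2 * k ^+ 2 * (2 * `|b| * K + K ^+ 2))),
  (Num.min tau (Num.min 1 (1 / (2 * L)))).
split.
- apply: mulr_ge0; first exact: expR_ge0.
  apply: addr_ge0; first exact: mulr_ge0.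
  apply: mulr_ge0; first by rewrite mulr_ge0 ?sqr_ge0.
  by apply: addr_ge0; rewrite ?sqr_ge0// !mulr_ge0.
- by rewrite !lt_min tau0 ltr01 divr_gt0 ?mulr_gt0.
move=> t; rewrite !le_min => /and3P[t1 t2]; rewrite ler_pdivlMr ?mulr_gt0// => tL.
have fle := fP t t1; set s := `|t| in t1 t2 tL fle *.
have s0 : 0 <= s by exact: normr_ge0.
have ts : t ^+ 2 = s ^+ 2 by rewrite real_normK ?num_real.
set z := c * t ^+ 2 + C * s ^+ 3.
have s3 : s ^+ 3 <= s ^+ 2 by rewrite exprSr ler_piMr ?sqr_ge0.
have s2 : s ^+ 2 <= s by rewrite expr2 ler_piMl.
have zb : `|z| <= K * s ^+ 2.
  apply: (le_trans (ler_normD _ _)); rewrite (normrM c) (normrM C).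
  rewrite [`|t ^+ 2|]ger0_norm ?sqr_ge0// ts (ger0_norm C0) [`|s ^+ 3|]ger0_norm ?exprn_ge0// /K mulrDl lerD2l.
  by rewrite ler_wpM2l.
set y := k * (b * t + z).
have yb : `|y| <= 1 / 2.
  rewrite normrM (ger0_norm k0).
  have h1 : `|b * t + z| <= (`|b| + K) * s.
    apply: (le_trans (ler_normD _ _)); rewrite normrM -/s mulrDl lerD2l.
    by apply: (le_trans zb); rewrite ler_wpM2l.
  have := ler_wpM2l k0 h1; rewrite /L in tL; lra.
have y2 : (b * t + z) ^+ 2 <= b ^+ 2 * t ^+ 2 + (2 * `|b| * K + K ^+ 2) * s ^+ 3.
  have h1 : b * t * z <= `|b| * K * s ^+ 3.
    apply: (le_trans (ler_norm _)); rewrite 2!normrM -/s -!mulrA ler_wpM2l//.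
    by rewrite exprS mulrCA ler_wpM2l.
  have h2 : z ^+ 2 <= K ^+ 2 * s ^+ 3.
    rewrite -[z ^+ 2]real_normK ?num_real//.
    apply: (@le_trans _ _ ((K * s ^+ 2) ^+ 2)).
      by rewrite ler_pXn2r// ?nnegrE ?mulr_ge0 ?exprn_ge0.
    rewrite exprMn ler_wpM2l ?sqr_ge0// -exprM.
    by rewrite (exprSr s 3) ler_piMr ?exprn_ge0.
  lra.
apply: (@le_trans _ _ (expR (k * a) * expR y)).
  rewrite -expRD ler_expR /y /z; have := ler_wpM2l k0 fle; lra.
have -> : expR (k * a) + expR (k * a) * (k * b) * t
  + expR (k * a) * (k * c + 2 * k ^+ 2 * b ^+ 2) * t ^+ 2
  + expR (k * a) * (k * C + 2 * k ^+ 2 * (2 * `|b| * K + K ^+ 2)) * s ^+ 3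
  = expR (k * a) * (1 + y + 2 * k ^+ 2 * (b ^+ 2 * t ^+ 2 + (2 * `|b| * K + K ^+ 2) * s ^+ 3)).
  by rewrite /y /z; ring.
rewrite ler_wpM2l ?expR_ge0//; apply: (le_trans (expR_le_quadratic yb)).
rewrite lerD2l -mulrA ler_wpM2l// /y exprMn ler_wpM2l ?sqr_ge0//.
Qed.

(** The sign of [t] is chosen against [b], so the linear term never hurts, and near 0 the negative
    quadratic term beats the cubic error. *)
Lemma upper_jet_descent (R : realType) (f : R -> R) (a b c tau0 : R) :
  upper_jet f a b c -> c < 0 -> 0 < tau0 ->
  exists t, [/\ t != 0, `|t| <= tau0 & f t <= a].
Proof.
move=> [C [tau [C0 tau_gt0 fP]]] c0 tau0_gt0.
have C1 : 0 < C + 1 by lra.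
set s := Num.min tau0 (Num.min tau (- c / (C + 1))).
have s0 : 0 < s by rewrite !lt_min tau0_gt0 tau_gt0 divr_gt0// oppr_gt0.
have := lexx s; rewrite {2}/s !le_min ler_pdivlMr// => /and3P[s1 s2 s3].
pose t := if 0 <= b then - s else s.
have tn : `|t| = s by rewrite /t; case: ifP; rewrite ?normrN gtr0_norm.
have bt : b * t <= 0.
  rewrite /t; case: ifPn => [b0|]; first by rewrite mulrN oppr_le0 mulr_ge0// ltW.
  by rewrite -ltNge => b0; rewrite mulr_le0_ge0 ?ltW.
exists t; split; rewrite ?tn//; first by rewrite -normr_gt0 tn.
have := fP t; rewrite tn => /(_ s2) /le_trans; apply.
rewrite -[t ^+ 2]real_normK ?num_real// tn.
have h : c + C * s <= 0 by lra.
have := mulr_ge0_le0 (sqr_ge0 s) h; lra.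
Qed.

(** * Barriers, loads, the potential and feasible points *)

Definition alive (R : realType) (n m : nat) (a : 'I_m -> 'I_n -> R)
    (V : {set 'I_n}) (j : 'I_m) : R := \sum_(i in V) a j i.

Definition disp (R : realType) (n m : nat) (a : 'I_m -> 'I_n -> R)
    (x : 'I_n -> R) (j : 'I_m) : R := \sum_i a j i * x i.

Definition mass (R : realType) (n m : nat) (a : 'I_m -> 'I_n -> R)
    (V : {set 'I_n}) (x : 'I_n -> R) (j : 'I_m) : R :=
  \sum_(i in V) a j i * x i ^+ 2.

(** Small enough that the discrepancies use under a tenth of [Nv] in [second_order_bound]; the
    inverse of its square root, 1000, is the constant of [disp_le]. *)
Definition lam (R : realType) : R := (1000 * 1000)^-1.

(* With [sg = sqrt alive], the last two terms are
   [- rho / 16 * (sg + (alive - mass) / sg)]: the tangent of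
   [e |-> - rho / 8 * sqrt e] at [e = alive], taken at the energy
   [e = alive - mass], so that [slack] is quadratic in [x] while [V] is fixed. *)
Definition slack (R : realType) (n m : nat) (a : 'I_m -> 'I_n -> R) (rho : R)
    (V : {set 'I_n}) (x : 'I_n -> R) (j : 'I_m) : R :=
  let sg := Num.sqrt (alive a V j) in
  rho ^+ 2 - lam R * disp a x j ^+ 2 - rho * sg / 8
    + rho / (16 * sg) * mass a V x j.

(* [4 / rho ^+ 2] is the largest load that a row of discrepancy 0 can have when
   it ceases to be big, see [slack_ge_half] and [load_half_le]. *)
Definition load (R : realType) (n m : nat) (a : 'I_m -> 'I_n -> R) (rho : R)
    (V : {set 'I_n}) (x : 'I_n -> R) (j : 'I_m) : R :=
  if 16 * rho ^+ 2 < alive a V j then 4 / rho ^+ 2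
  else if rho <= alive a V j then rho ^+ 2 / slack a rho V x j ^+ 2 else 0.

Definition elem_load (R : realType) (n m : nat) (a : 'I_m -> 'I_n -> R) (rho : R)
    (V : {set 'I_n}) (x : 'I_n -> R) (i : 'I_n) : R :=
  \sum_j a j i * load a rho V x j.

(** The squared norm is subtracted to give second-order room: it offsets the regularizing term that
    keeps the weights [D] positive. On the cube it is at most [n], so little is lost in bounding the
    loads. *)
Definition potential (R : realType) (n m : nat) (a : 'I_m -> 'I_n -> R)
    (rho beta : R) (V : {set 'I_n}) (x : 'I_n -> R) : R :=
  \sum_(i in V) expR (beta * elem_load a rho V x i) - \sum_i x i ^+ 2.

Definition active (R : realType) (n m : nat) (a : 'I_m -> 'I_n -> R) (rho : R)
    (V : {set 'I_n}) : {set 'I_m} :=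
  [set j | rho <= alive a V j <= 16 * rho ^+ 2].

(* In the fourth condition [alive] is added so that the bound survives any
   later rounding of the alive elements of a small row. *)
Definition feasible (R : realType) (n m : nat) (a : 'I_m -> 'I_n -> R)
    (rho beta : R) (V : {set 'I_n}) (x : 'I_n -> R) : Prop :=
  [/\ (forall i, `|x i| <= 1) /\ (forall i, i \notin V -> `|x i| = 1),
      forall j, 16 * rho ^+ 2 < alive a V j -> disp a x j = 0,
      forall j, j \in active a rho V ->
        rho * Num.sqrt (alive a V j) / 18 <= slack a rho V x j,
      forall j, alive a V j < rho ->
        `|\sum_(i in ~: V) a j i * x i| + alive a V j <= 1002 * rho &
      potential a rho beta V x <= n%:R * expR (4 * beta)].

(** The value of [expR (4 * beta)] makes [expR (8 * beta)] at least [n%:R * expR (4 * beta) + n%:R],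
    see [elem_load_le]; [512 * beta <= rho] is the trace condition of the cut in the space of
    rows. *)
Definition setting (R : realType) (n m : nat) (a : 'I_m -> 'I_n -> R)
    (rho beta : R) : Prop :=
  [/\ forall j i, a j i = 0 \/ a j i = 1,
      forall i, \sum_j a j i <= rho ^+ 2,
      400 <= rho, 0 < beta /\ 512 * beta <= rho & expR (4 * beta) = 2 * n%:R].

Lemma lam_gt0 (R : realType) : 0 < lam R.
Proof. rewrite invr_gt0; lra. Qed.

Lemma lamE (R : realType) : lam R * 1000 * 1000 = 1.
Proof.
have cancel (z : R) : 0 < z -> (z * z)^-1 * z * z = 1.
  by move=> z0; field; rewrite gt_eqF.
apply: cancel; lra.
Qed.

Lemma setting_a (R : realType) n m (a : 'I_m -> 'I_n -> R) rho beta :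
  setting a rho beta -> [/\ forall j i, 0 <= a j i, forall j i, a j i <= 1,
    forall j i, a j i ^+ 2 = a j i & 0 < rho].
Proof.
case=> a01 _ r _ _; split; last (by move: r; clear; lra);
by move=> j i; case: (a01 j i) => ->; rewrite ?expr0n ?expr1n.
Qed.

Lemma alive_ge0 (R : realType) n m (a : 'I_m -> 'I_n -> R) rho beta V j :
  setting a rho beta -> 0 <= alive a V j.
Proof. by move=> /setting_a[a0 _ _ _]; apply: sumr_ge0. Qed.

Lemma mass_bounds (R : realType) n m (a : 'I_m -> 'I_n -> R) rho beta V x j :
  setting a rho beta -> (forall i, `|x i| <= 1) -> 0 <= mass a V x j <= alive a V j.
Proof.
move=> /setting_a[a0 _ _ _] x1; apply/andP; split.
  by apply: sumr_ge0 => i _; rewrite mulr_ge0 ?sqr_ge0.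
apply: ler_sum => i _; rewrite ler_piMr// -[x i ^+ 2]real_normK ?num_real//.
by rewrite expr_le1.
Qed.

(** The form suited to varying [V]: the energy [alive - mass] does not change when frozen
    coordinates are dropped, so only [sg] does. *)
Lemma slackE (R : realType) n m (a : 'I_m -> 'I_n -> R) rho beta V x j
    (sg := Num.sqrt (alive a V j)) :
  setting a rho beta -> 0 < alive a V j ->
  slack a rho V x j = rho ^+ 2 - lam R * disp a x j ^+ 2
    - rho / 16 * (sg + (alive a V j - mass a V x j) / sg).
Proof.
move=> st al0; have sg0 : 0 < sg by rewrite sqrtr_gt0.
have sg2 : alive a V j = sg ^+ 2 by rewrite sqr_sqrtr// ltW.
by rewrite /slack -/sg [alive a V j in RHS]sg2; field; rewrite gt_eqF.
Qed.

Lemma sqrt_alive_le (R : realType) n m (a : 'I_m -> 'I_n -> R) rho beta V j :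
  setting a rho beta -> alive a V j <= 16 * rho ^+ 2 ->
  Num.sqrt (alive a V j) <= 4 * rho.
Proof.
move=> st al16; have [_ _ _ rho0] := setting_a st.
rewrite -(@ler_pXn2r _ 2) ?nnegrE ?sqrtr_ge0 ?mulr_ge0 ?(ltW rho0)//.
rewrite sqr_sqrtr ?(alive_ge0 _ _ st)//; apply: (le_trans al16).
by rewrite le_eqVlt; apply/orP; left; apply/eqP; ring.
Qed.

Lemma slack_ge_half (R : realType) n m (a : 'I_m -> 'I_n -> R) rho beta V x j :
  setting a rho beta -> (forall i, `|x i| <= 1) -> alive a V j <= 16 * rho ^+ 2 ->
  disp a x j = 0 -> rho ^+ 2 / 2 <= slack a rho V x j.
Proof.
move=> st x1 al16 d0; have [_ _ _ rho0] := setting_a st.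
have /andP[ms0 _] := mass_bounds V j st x1.
rewrite /slack d0 expr0n mulr0 subr0 /=.
have : 0 <= rho / (16 * Num.sqrt (alive a V j)) * mass a V x j.
  by rewrite mulr_ge0 ?divr_ge0 ?mulr_ge0 ?sqrtr_ge0 ?(ltW rho0).
move: (ler_wpM2l (ltW rho0) (sqrt_alive_le st al16)).
by set p := _ / _ * _; clear; lra.
Qed.

Lemma threshold_le_half (R : realType) n m (a : 'I_m -> 'I_n -> R) rho beta V j :
  setting a rho beta -> alive a V j <= 16 * rho ^+ 2 ->
  rho * Num.sqrt (alive a V j) / 18 <= rho ^+ 2 / 2.
Proof.
move=> st al16; have [_ _ _ rho0] := setting_a st.
move: (ler_wpM2l (ltW rho0) (sqrt_alive_le st al16)) (sqr_ge0 rho).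
by clear; lra.
Qed.

Lemma load_half_le (R : realType) (rho s : R) : 0 < rho -> rho ^+ 2 / 2 <= s ->
  rho ^+ 2 / s ^+ 2 <= 4 / rho ^+ 2.
Proof.
move=> rho0 s2; have r2 : 0 < rho ^+ 2 by rewrite exprn_gt0.
have s0 : 0 < s by apply: lt_le_trans s2; rewrite divr_gt0.
rewrite ler_pdivrMr ?exprn_gt0// mulrAC ler_pdivlMr//.
have : (rho ^+ 2 / 2) ^+ 2 <= s ^+ 2 by rewrite ler_pXn2r// nnegrE ltW ?divr_gt0.
by clear; lra.
Qed.

Lemma lam_disp_le (R : realType) n m (a : 'I_m -> 'I_n -> R) rho beta V x j :
  setting a rho beta -> (forall i, `|x i| <= 1) -> 0 < alive a V j ->
  0 <= slack a rho V x j -> lam R * disp a x j ^+ 2 <= rho ^+ 2.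
Proof.
move=> st x1 al0; have [_ _ _ rho0] := setting_a st.
have /andP[_ ms1] := mass_bounds V j st x1.
rewrite (slackE x st)//.
have : 0 <= rho / 16 * (Num.sqrt (alive a V j) +
    (alive a V j - mass a V x j) / Num.sqrt (alive a V j)).
  by rewrite mulr_ge0 ?divr_ge0 ?(ltW rho0)// addr_ge0 ?divr_ge0 ?sqrtr_ge0// subr_ge0.
by set p := _ / _ * _; set q := lam R * _; clear; lra.
Qed.

Lemma disp_le (R : realType) n m (a : 'I_m -> 'I_n -> R) rho beta V x j :
  setting a rho beta -> (forall i, `|x i| <= 1) -> 0 < alive a V j ->
  0 <= slack a rho V x j -> `|disp a x j| <= 1000 * rho.
Proof.
move=> st x1 al0 sl0; have [_ _ _ rho0] := setting_a st.
have := lam_disp_le st x1 al0 sl0; set d := disp a x j => ld.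
have d2 : d ^+ 2 <= (1000 * rho) ^+ 2.
  have -> : d ^+ 2 = 1000 * 1000 * (lam R * d ^+ 2).
    have -> : 1000 * 1000 * (lam R * d ^+ 2) = lam R * 1000 * 1000 * d ^+ 2 by ring.
    by rewrite lamE mul1r.
  move: ld; set q := lam R * _; clear; lra.
have r1000 : 0 <= 1000 * rho by move: rho0; clear; lra.
by rewrite -(@ler_pXn2r _ 2) ?nnegrE// real_normK ?num_real.
Qed.

(** * Freezing coordinates, the starting point and the bound on loads *)

Lemma alive_shrink (R : realType) n m (a : 'I_m -> 'I_n -> R) rho beta
    (V' V : {set 'I_n}) j :
  setting a rho beta -> V' \subset V -> alive a V' j <= alive a V j.
Proof.
move=> /setting_a[a0 _ _ _] /finset.setIidPr VV'; rewrite /alive [leRHS](big_setID V') VV' /=.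
by rewrite lerDl sumr_ge0.
Qed.

(** With the energy [s] fixed, [sg + s / sg] drops by [(sg - sg') (1 - s / (sg sg'))] when [sg]
    falls to [sg']; this is nonnegative since [s <= sg'^2]. *)
Lemma slack_shrink (R : realType) n m (a : 'I_m -> 'I_n -> R) rho beta
    (V' V : {set 'I_n}) x j :
  setting a rho beta -> V' \subset V -> (forall i, `|x i| <= 1) ->
  (forall i, i \in V -> i \notin V' -> `|x i| = 1) -> 0 < alive a V' j ->
  slack a rho V x j <= slack a rho V' x j.
Proof.
move=> st VV' x1 xV al'0; have [_ _ _ rho0] := setting_a st.
have all := alive_shrink j st VV'.
have al0 : 0 < alive a V j := lt_le_trans al'0 all.
rewrite !(slackE x st)//.
have -> : alive a V j - mass a V x j = alive a V' j - mass a V' x j.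
  rewrite -!sumrB [LHS](big_setID V') (finset.setIidPr VV') /=.
  rewrite [X in _ + X]big1 ?addr0// => i; rewrite inE => /andP[iV' iV].
  by rewrite -[x i ^+ 2]real_normK ?num_real// xV// expr1n mulr1 subrr.
have /andP[ms0 ms1] := mass_bounds V' j st x1.
set sg := Num.sqrt (alive a V j); set sg' := Num.sqrt (alive a V' j).
have sg0 : 0 < sg by rewrite sqrtr_gt0.
have sg'0 : 0 < sg' by rewrite sqrtr_gt0.
have sgl : sg' <= sg by rewrite ler_sqrt// ltW.
have al'E : alive a V' j = sg' ^+ 2 by rewrite sqr_sqrtr// ltW.
set s := _ - mass a V' x j.
have s_le : s <= sg * sg'.
  apply: (@le_trans _ _ (sg' ^+ 2)); first by rewrite -al'E lerBlDr lerDl.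
  by rewrite expr2 ler_wpM2r// ltW.
rewrite lerD2l lerN2 ler_wpM2l ?divr_ge0 ?(ltW rho0)//.
rewrite -subr_ge0.
have -> : sg + s / sg - (sg' + s / sg') = (sg - sg') * (1 - s / (sg * sg')).
  by field; rewrite !gt_eqF.
by rewrite mulr_ge0 ?subr_ge0// ler_pdivrMr ?mulr_gt0// mul1r.
Qed.

Lemma feasible_slack (R : realType) n m (a : 'I_m -> 'I_n -> R) rho beta V x j :
  setting a rho beta -> feasible a rho beta V x -> j \in active a rho V ->
  [/\ 0 < alive a V j, 0 < slack a rho V x j &
      rho * Num.sqrt (alive a V j) / 18 <= slack a rho V x j].
Proof.
move=> st [_ _ act _ _] jQ; have [_ _ _ rho0] := setting_a st.
have al0 : 0 < alive a V j.
  by move: jQ; rewrite inE => /andP[+ _]; exact: lt_le_trans.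
split => //; last exact: act.
by apply: lt_le_trans (act j jQ); rewrite divr_gt0 ?mulr_gt0 ?sqrtr_gt0.
Qed.

Lemma load_ge0 (R : realType) n m (a : 'I_m -> 'I_n -> R) rho V x j :
  0 <= load a rho V x j.
Proof.
by rewrite /load; case: ifP => _; [|case: ifP => _]; rewrite // divr_ge0 ?sqr_ge0.
Qed.

(** Rows only pass from big to active to small. A row that stops being big has discrepancy 0, hence
    a large slack and a load of at most [4 / rho ^+ 2]; a row that becomes small has discrepancy at
    most [1000 * rho]; slacks of active rows only grow. *)
Lemma feasible_shrink (R : realType) n m (a : 'I_m -> 'I_n -> R) rho beta
    (V' V : {set 'I_n}) x :
  setting a rho beta -> V' \subset V ->
  (forall i, i \in V -> i \notin V' -> `|x i| = 1) ->
  feasible a rho beta V x -> feasible a rho beta V' x.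
Proof.
move=> st VV' xV fs; have [[x1 xoff] big act small pot] := fs.
have [a0 _ _ rho0] := setting_a st.
have all j := alive_shrink j st VV'.
have old j : rho <= alive a V' j ->
    16 * rho ^+ 2 < alive a V j \/ j \in active a rho V.
  move=> r; case: (ltP (16 * rho ^+ 2) (alive a V j)) => h; first by left.
  by right; rewrite inE h (le_trans r).
have slack' j : j \in active a rho V' -> slack a rho V x j <= slack a rho V' x j.
  rewrite inE => /andP[r _]; apply: slack_shrink st _ _ _ _ => //.
  exact: lt_le_trans r.
split.
- by split=> // i iV'; case: (boolP (i \in V)) => [/xV->|/xoff].
- by move=> j h; apply: big; apply: lt_le_trans (all j).
- move=> j jQ; have := jQ; rewrite inE => /andP[r r16].
  case: (old j r) => [/big d0|jQV].
    by apply: le_trans (slack_ge_half st x1 r16 d0); exact: threshold_le_half st r16.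
  apply: le_trans (slack' j jQ); apply: le_trans (act j jQV).
  by rewrite ler_wpM2r// ler_wpM2l ?(ltW rho0)// ler_wsqrtr.
- move=> j h.
  have free (U : {set 'I_n}) : `|\sum_(i in U) a j i * x i| <= alive a U j.
    apply: (le_trans (ler_norm_sum _ _ _)); apply: ler_sum => i _.
    by rewrite normrM (ger0_norm (a0 j i)) ler_piMr.
  have [r|r] := ltP (alive a V j) rho.
    apply: le_trans (small j r).
    rewrite (big_setID (~: V)) /=.
    have -> : ~: V' :&: ~: V = ~: V by apply/finset.setIidPr; rewrite finset.setCS.
    have -> : ~: V' :\: ~: V = V :\: V' by apply/finset.setP => i; rewrite !inE negbK andbC.
    have -> : alive a V j = alive a (V :\: V') j + alive a V' j.
      by rewrite /alive addrC [LHS](big_setID V') (finset.setIidPr VV').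
    rewrite addrA lerD2r; apply: (le_trans (ler_normD _ _)); rewrite lerD2l.
    exact: free.
  have dl : `|disp a x j| <= 1000 * rho.
    case: (ltP (16 * rho ^+ 2) (alive a V j)) => h16.
      rewrite big // normr0; move: rho0; clear; lra.
    have jQ : j \in active a rho V by rewrite inE r h16.
    have [al0 sl0 _] := feasible_slack st fs jQ.
    exact: disp_le st x1 al0 (ltW sl0).
  (* Leaving out the alive part costs at most [alive], and the condition adds [alive] once more:
     hence [1000 + 2]. *)
  have -> : \sum_(i in ~: V') a j i * x i = disp a x j - \sum_(i in V') a j i * x i.
    rewrite /disp [X in X - _](bigID (mem V')) /= addrAC subrr add0r.
    by apply: eq_bigl => i; rewrite inE.
  move: (ler_normB (disp a x j) (\sum_(i in V') a j i * x i)) (free V') dl h.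
  set p := `|_ - _|; set d := `|_|; set z := `|_|; set al := alive a V' j.
  by clear; lra.
- apply: le_trans pot; rewrite lerD2r [leRHS](big_setID V') (finset.setIidPr VV') /=.
  rewrite -[leLHS]addr0; apply: lerD; last by apply: sumr_ge0 => i _; exact: expR_ge0.
  apply: ler_sum => i _; rewrite ler_expR; apply: ler_wpM2l.
    by case: st => _ _ _ [/ltW].
  apply: ler_sum => j _; apply: ler_wpM2l => //.
  rewrite {1}/load; case: ltP => [h|h16]; first by rewrite /load (lt_le_trans h).
  case: (leP rho (alive a V' j)) => r; last by apply: load_ge0.
  have jQ : j \in active a rho V' by rewrite inE r.
  have sl := slack' j jQ.
  rewrite /load; case: ltP => [/big d0|h16'].
    by apply: load_half_le => //; exact: slack_ge_half st x1 h16 d0.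
  rewrite (le_trans r (all j)).
  have jQV : j \in active a rho V by rewrite inE h16' (le_trans r (all j)).
  have [_ sl0 _] := feasible_slack st fs jQV.
  rewrite ler_wpM2l ?sqr_ge0// lef_pV2 ?posrE ?exprn_gt0 ?(lt_le_trans sl0)//.
  by rewrite ler_pXn2r// nnegrE ltW// (lt_le_trans sl0).
Qed.

(** All discrepancies are 0, so each row has load at most [4 / rho ^+ 2]; column sums of at most
    [rho ^+ 2] then give each element load at most 4. *)
Lemma feasible_start (R : realType) n m (a : 'I_m -> 'I_n -> R) rho beta :
  setting a rho beta -> feasible a rho beta [set: 'I_n] (fun=> 0).
Proof.
move=> st; have [a0 _ _ rho0] := setting_a st.
have d0 j : disp a (fun=> 0) j = 0 by rewrite /disp big1// => i _; rewrite mulr0.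
have x1 (i : 'I_n) : `|0 : R| <= 1 by rewrite normr0.
split => //.
- by split => // i; rewrite inE.
- move=> j; rewrite inE => /andP[_ h].
  by apply: le_trans (slack_ge_half st x1 h (d0 j)); exact: threshold_le_half st h.
- move=> j h; rewrite big1 ?normr0 ?add0r; last by move=> i _; rewrite mulr0.
  by move: h rho0; set al := alive _ _ _; clear; lra.
- rewrite /potential [X in _ - X]big1 ?subr0; last by move=> i _; rewrite expr0n.
  apply: (@le_trans _ _ (\sum_(i in [set: 'I_n]) expR (4 * beta))); last first.
    by rewrite sumr_const cardsT card_ord [leRHS]mulr_natl.
  have [_ col _ [beta0 _] _] := st.
  apply: ler_sum => i _; rewrite ler_expR mulrC ler_wpM2r ?(ltW beta0)//.
  apply: (@le_trans _ _ (\sum_j a j i * (4 / rho ^+ 2))).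
    apply: ler_sum => j _; rewrite ler_wpM2l// /load; case: ltP => // h.
    case: ifP => _; last by rewrite divr_ge0 ?sqr_ge0.
    by apply: load_half_le => //; exact: slack_ge_half st x1 h (d0 j).
  rewrite -mulr_suml mulrCA ger_pMr// ler_pdivrMr ?exprn_gt0// mul1r.
  exact: col.
Qed.

(** One term of the potential is at most [n%:R * expR (4 * beta)] plus the squared norm of [x],
    hence at most [2 * n%:R * expR (4 * beta)], which is [expR (8 * beta)]. *)
Lemma elem_load_le (R : realType) n m (a : 'I_m -> 'I_n -> R) rho beta V x i :
  setting a rho beta -> feasible a rho beta V x -> i \in V ->
  elem_load a rho V x i <= 8.
Proof.
move=> [_ _ _ [beta0 _] e4] [[x1 _] _ _ _ pot] iV.
have sq_le : \sum_l x l ^+ 2 <= n%:R.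
  rewrite -[n in n%:R]card_ord -sum1_card natr_sum; apply: ler_sum => l _.
  by rewrite -[x l ^+ 2]real_normK ?num_real// expr_le1.
have n1 : 1 <= n%:R :> R by rewrite ler1n; case: n i {a V x x1 pot iV e4 sq_le} => [[]|].
rewrite -(ler_pM2l beta0) -ler_expR.
have -> : beta * 8 = 4 * beta + 4 * beta by ring.
rewrite expRD {2}e4; apply: (@le_trans _ _ (n%:R * expR (4 * beta) + \sum_l x l ^+ 2)).
  rewrite -lerBlDr; apply: le_trans pot; rewrite lerD2r (bigD1 i)//= lerDl.
  by apply: sumr_ge0 => l _; exact: expR_ge0.
have : 1 <= expR (4 * beta) by rewrite -expR0 ler_expR mulr_ge0 ?(ltW beta0).
have nn : 0 <= n%:R :> R by [].
move=> /(ler_wpM2l nn); move: sq_le; set w := \sum_l _; set z := expR _.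
by clear; lra.
Qed.

(** * Behaviour along a line and double counting of rows *)

Lemma upper_jet_ext (R : realType) (f g : R -> R) (a b c : R) :
  (forall t, f t = g t) -> upper_jet g a b c -> upper_jet f a b c.
Proof.
move=> fg [C [tau [C0 tau0 gP]]]; exists C, tau; split=> // t /gP.
by rewrite fg.
Qed.

Lemma common_radius (R : realType) (K : finType) (P : K -> R -> Prop) :
  (forall k, exists tau, 0 < tau /\ forall t, `|t| <= tau -> P k t) ->
  exists tau, 0 < tau /\ forall k t, `|t| <= tau -> P k t.
Proof.
move=> near.
suff [tau [tau0 h]] : exists tau, 0 < tau /\
    forall k, k \in enum K -> forall t, `|t| <= tau -> P k t.
  by exists tau; split=> // k t; apply: h; rewrite mem_enum.
elim: (enum K) => [|k s [tau [tau0 IH]]]; first by exists 1.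
have [tau' [tau'0 h]] := near k.
exists (Num.min tau tau'); rewrite lt_min tau0; split=> // l.
rewrite inE => /orP[/eqP->|ls] t; rewrite le_min => /andP[t1 t2]; first exact: h.
exact: IH.
Qed.

Lemma quadratic_ge0_near (R : realType) (A B C : R) : 0 < A ->
  exists tau, 0 < tau /\ forall t, `|t| <= tau -> 0 <= A + B * t + C * t ^+ 2.
Proof.
move=> A0; set K := `|B| + `|C| + 1.
have K0 : 0 < K by rewrite ltr_wpDl ?addr_ge0.
exists (Num.min 1 (A / K)); rewrite lt_min ltr01 divr_gt0//; split=> // t.
rewrite le_min => /andP[t1]; rewrite ler_pdivlMr// => tK.
have h1 : - (`|B| * `|t|) <= B * t by rewrite -normrM lerNl ler_normr lexx orbT.
have h2 : - (`|C| * `|t|) <= C * t ^+ 2.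
  rewrite lerNl; apply: (@le_trans _ _ `|C * t ^+ 2|).
    by rewrite ler_normr lexx orbT.
  rewrite normrM ler_wpM2l// [`|t ^+ 2|]ger0_norm ?sqr_ge0//.
  by rewrite -real_normK ?num_real// expr2 ler_piMr.
have := normr_ge0 t; move: h1 h2 tK; rewrite /K; clear; lra.
Qed.

Lemma disp_line (R : realType) n m (a : 'I_m -> 'I_n -> R) (V : {set 'I_n}) x v t j :
  (forall i, i \notin V -> v i = 0) ->
  disp a (fun i => x i + t * v i) j = disp a x j + t * \sum_(i in V) a j i * v i.
Proof.
move=> v0; rewrite /disp.
have -> : \sum_(i in V) a j i * v i = \sum_i a j i * v i.
  rewrite [RHS](bigID (mem V)) /= [X in _ + X]big1 ?addr0// => i /v0 ->.
  by rewrite mulr0.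
by rewrite mulr_sumr -big_split; apply: eq_bigr => i _ /=; ring.
Qed.

Lemma slack_line (R : realType) n m (a : 'I_m -> 'I_n -> R) rho (V : {set 'I_n}) x v t j
    (kap := rho / (16 * Num.sqrt (alive a V j)))
    (al := \sum_(i in V) a j i * v i) (xi := \sum_(i in V) a j i * x i * v i) :
  (forall i, i \notin V -> v i = 0) ->
  slack a rho V (fun i => x i + t * v i) j = slack a rho V x j
    + (2 * kap * xi - 2 * lam R * disp a x j * al) * t
    + (kap * (\sum_(i in V) a j i * v i ^+ 2) - lam R * al ^+ 2) * t ^+ 2.
Proof.
move=> v0; rewrite /slack (disp_line _ _ _ _ v0) -/al -/kap.
have -> : mass a V (fun i => x i + t * v i) j
    = mass a V x j + 2 * t * xi + t ^+ 2 * \sum_(i in V) a j i * v i ^+ 2.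
  rewrite /mass /xi !mulr_sumr -!big_split; apply: eq_bigr => i _ /=; ring.
set l := lam R; set d := disp _ _ _; set s := Num.sqrt _; set ms := mass _ _ _ _.
set nv := \sum_(i in V) a j i * v i ^+ 2; move: kap al xi l d s ms nv; clear.
by move=> kap al xi l d s ms nv; ring.
Qed.

Lemma load_inactive (R : realType) n m (a : 'I_m -> 'I_n -> R) rho (V : {set 'I_n}) x y j :
  j \notin active a rho V -> load a rho V y j = load a rho V x j.
Proof. by rewrite inE /load; case: ltP => // _; rewrite andbT => /negbTE ->. Qed.

Lemma load_active (R : realType) n m (a : 'I_m -> 'I_n -> R) rho (V : {set 'I_n}) x j :
  j \in active a rho V -> load a rho V x j = rho ^+ 2 / slack a rho V x j ^+ 2.
Proof. by rewrite inE /load => /andP[-> ]; case: ltP. Qed.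

Lemma sum_alive_mul (R : realType) n m (a : 'I_m -> 'I_n -> R) (V : {set 'I_n}) (c : 'I_m -> R) :
  \sum_j alive a V j * c j = \sum_(i in V) \sum_j a j i * c j.
Proof. by rewrite exchange_big; apply: eq_bigr => j _; rewrite mulr_suml. Qed.

Lemma sum_alive_load_le (R : realType) n m (a : 'I_m -> 'I_n -> R) rho beta V x (S : {set 'I_m}) :
  setting a rho beta -> feasible a rho beta V x ->
  \sum_(j in S) alive a V j * load a rho V x j <= 8 * #|V|%:R.
Proof.
move=> st fs; apply: (@le_trans _ _ (\sum_j alive a V j * load a rho V x j)).
  rewrite [leRHS](bigID (mem S)) /= lerDl; apply: sumr_ge0 => j _.
  by rewrite mulr_ge0 ?load_ge0 ?(alive_ge0 _ _ st).
rewrite sum_alive_mul -sum1_card natr_sum mulr_sumr; apply: ler_sum => i iV.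
by rewrite mulr1; exact: elem_load_le st fs iV.
Qed.

Lemma card_big_le (R : realType) n m (a : 'I_m -> 'I_n -> R) rho beta V :
  setting a rho beta ->
  (#|[set j | (16 * rho ^+ 2 < alive a V j)%R]| * 16 <= #|V|)%N.
Proof.
move=> st; have [a0 _ _ rho0] := setting_a st; have [_ col _ _ _] := st.
set B := [set j | _]; have r2 : 0 < rho ^+ 2 by rewrite exprn_gt0.
rewrite -(ler_nat R) natrM -(ler_pM2r r2).
apply: (@le_trans _ _ (\sum_(j in B) alive a V j)).
  rewrite -sum1_card natr_sum !mulr_suml; apply: ler_sum => j; rewrite inE mul1r.
  exact: ltW.
apply: (@le_trans _ _ (\sum_j alive a V j * 1)).
  rewrite [leRHS](bigID (mem B)) /=.
  under [X in _ <= X + _]eq_bigr do rewrite mulr1.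
  by rewrite lerDl; apply: sumr_ge0 => j _; rewrite mulr1 (alive_ge0 _ _ st).
rewrite sum_alive_mul -sum1_card natr_sum mulr_suml; apply: ler_sum => i _.
by rewrite mul1r; under eq_bigr do rewrite mulr1; exact: col.
Qed.

(** At the threshold [rho * sg / 18] a row has [alive * load = 18^2 = 324], while these products sum
    to at most [8 * #|V|]. *)
Lemma card_tight_le (R : realType) n m (a : 'I_m -> 'I_n -> R) rho beta V x :
  setting a rho beta -> feasible a rho beta V x ->
  (#|[set j in active a rho V |
      slack a rho V x j == rho * Num.sqrt (alive a V j) / 18]| * 40 <= #|V|)%N.
Proof.
move=> st fs; have [_ _ _ rho0] := setting_a st.
set T := [set j in _ | _]; rewrite -(ler_nat R) natrM.
have : \sum_(j in T) 324 <= 8 * #|V|%:R :> R.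
  apply: le_trans (sum_alive_load_le T st fs); apply: ler_sum => j.
  rewrite inE => /andP[jQ /eqP tight].
  have [al0 _ _] := feasible_slack st fs jQ.
  rewrite load_active// tight exprMn exprMn sqr_sqrtr ?(ltW al0)//.
  rewrite le_eqVlt; apply/orP; left; apply/eqP.
  by field; rewrite !gt_eqF.
rewrite sumr_const -mulr_natr; have := ler0n R #|T|; set c := #|T|%:R; set e := #|V|%:R.
clear; lra.
Qed.

(** * A direction of descent and the improvement of interior points *)

Lemma feasible_direction (R : realType) n m (a : 'I_m -> 'I_n -> R) rho beta V x
    (Q := active a rho V) (sg := fun j => Num.sqrt (alive a V j))
    (u := slack a rho V x) (kap := fun j => rho / (16 * sg j))
    (E := fun i => expR (beta * elem_load a rho V x i)) :
  setting a rho beta -> feasible a rho beta V x -> (2 <= #|V|)%N ->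
  exists v : 'I_n -> R,
    let al j := \sum_(i in V) a j i * v i in
    let xi j := \sum_(i in V) a j i * x i * v i in
    let b j := 2 * kap j * xi j - 2 * lam R * disp a x j * al j in
    let q j := kap j * (\sum_(i in V) a j i * v i ^+ 2) - lam R * al j ^+ 2 in
    let w1 i := - (2 * rho ^+ 2 * \sum_(j in Q) a j i / u j ^+ 3 * b j) in
    let w2 i := rho ^+ 2 * \sum_(j in Q)
      a j i * (4 * b j ^+ 2 / u j ^+ 4 - 2 * q j / u j ^+ 3) in
    [/\ exists i, v i != 0, forall i, i \notin V -> v i = 0,
      \sum_(i in V) x i * v i = 0,
      forall j, 16 * rho ^+ 2 < alive a V j -> al j = 0 &
      forall j, j \in Q -> u j = rho * sg j / 18 -> al j = 0 /\ xi j = 0] /\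
    \sum_(i in V) E i * (beta * w2 i + 2 * beta ^+ 2 * w1 i ^+ 2)
      < \sum_(i in V) v i ^+ 2.
Proof.
move=> st fs V2; have [a0 a1 a2 rho0] := setting_a st.
have [a01 col rho400 [beta0 beta_rho] e4] := st.
have [[x1 _] _ _ _ _] := fs.
have r2 : 0 < rho ^+ 2 by rewrite exprn_gt0.
have E0 i : 0 < E i by rewrite expR_gt0.
have act j : j \in Q -> [/\ 0 < alive a V j, 0 < u j, 0 < sg j & rho * sg j / 18 <= u j].
  move=> jQ; have [al0 sl0 thr] := feasible_slack st fs jQ.
  by split=> //; rewrite sqrtr_gt0.
have sg2 j : sg j ^+ 2 = alive a V j by rewrite sqr_sqrtr// (alive_ge0 _ _ st).
pose G j := \sum_(i in V) E i * a j i.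
have G0 j : j \in Q -> 0 < G j.
  case/act => al0 _ _ _.
  have [i iV ai] : exists2 i, i \in V & a j i != 0.
    apply/exists_inP; apply: contraLR al0; rewrite negb_exists_in => /forall_inP h.
    rewrite -leNgt le_eqVlt; apply/orP; left; apply/eqP; apply: big1 => i /h.
    by rewrite negbK => /eqP.
  rewrite /G (bigD1 i)//= ltr_pwDl//.
    by rewrite mulr_gt0 ?E0// lt_neqAle eq_sym ai a0.
  by apply: sumr_ge0 => l _; rewrite mulr_ge0 ?a0 ?(ltW (E0 l)).
pose mm j := G j / u j ^+ 3.
have mm0 j : j \in Q -> 0 < mm j.
  by move=> jQ; have [_ u0 _ _] := act j jQ; rewrite divr_gt0 ?exprn_gt0 ?G0.
pose D i := \sum_(j in Q) kap j * mm j * a j i + (2 * beta * rho ^+ 2)^-1.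
have kap0 j : 0 <= kap j by rewrite divr_ge0 ?mulr_ge0 ?sqrtr_ge0 ?(ltW rho0).
have eps0 : 0 < (2 * beta * rho ^+ 2)^-1 by rewrite invr_gt0 !mulr_gt0.
have km0 j : j \in Q -> 0 <= kap j * mm j by move=> /mm0 h; rewrite mulr_ge0 ?(ltW h).
have kmD i : i \in V -> \sum_(j in Q) kap j * mm j * a j i <= D i.
  by move=> _; rewrite lerDl (ltW eps0).
have D0 i : i \in V -> 0 < D i.
  move=> _; rewrite ltr_wpDl//; apply: sumr_ge0 => j jQ.
  by rewrite mulr_ge0 ?km0 ?a0.
have h0 j : j \in Q -> 0 < mm j / u j.
  by move=> jQ; have [_ u0 _ _] := act j jQ; rewrite divr_gt0 ?mm0.
have br0 : 0 <= 8 * beta * rho ^+ 2 by rewrite !mulr_ge0 ?(ltW beta0) ?(ltW rho0).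
have g0 i : i \in V -> 0 <= 8 * beta * rho ^+ 2 * E i.
  by move=> _; rewrite mulr_ge0 ?(ltW (E0 i)).
have x2 i : x i ^+ 2 <= 1 by rewrite -[x i ^+ 2]real_normK ?num_real// expr_le1.
have trace : \sum_(i in V) 8 * beta * rho ^+ 2 * E i *
    (\sum_(j in Q) (a j i / u j ^+ 3) ^+ 2 / (mm j / u j)) * 8 <= #|V|%:R.
  rewrite -mulr_suml.
  (* Since [a] is 0-1, the sum over [i] reproduces [G j], which cancels: each row contributes
     [8 * beta] times its load. *)
  have -> : \sum_(i in V) 8 * beta * rho ^+ 2 * E i *
      (\sum_(j in Q) (a j i / u j ^+ 3) ^+ 2 / (mm j / u j))
      = 8 * beta * \sum_(j in Q) load a rho V x j.
    under eq_bigr do rewrite mulr_sumr.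
    rewrite exchange_big mulr_sumr; apply: eq_bigr => j jQ /=.
    have [_ u0 _ _] := act j jQ; have Gj := G0 j jQ.
    transitivity (\sum_(i in V) (8 * beta * rho ^+ 2 / (u j ^+ 2 * G j)) * (E i * a j i)).
      apply: eq_bigr => i _; rewrite -[in RHS]a2 /mm.
      by field; rewrite !gt_eqF.
    rewrite -mulr_sumr -/(G j) load_active// -/u.
    by field; rewrite !gt_eqF.
  (* Active rows have at least [rho] alive elements, so the total load is [O(#|V| / rho)]. *)
  have ll : rho * \sum_(j in Q) load a rho V x j <= 8 * #|V|%:R.
    apply: le_trans (sum_alive_load_le Q st fs).
    rewrite mulr_sumr; apply: ler_sum => j; rewrite inE => /andP[r _].
    by rewrite ler_wpM2r// load_ge0.
  have l0 : 0 <= \sum_(j in Q) load a rho V x j by apply: sumr_ge0 => j _; exact: load_ge0.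
  rewrite -(ler_pM2l rho0).
  move: (ler_wpM2l (ltW beta0) ll) (ler_wpM2r (ler0n R #|V|) beta_rho).
  set s := \sum_(j in Q) _; set c := #|V|%:R; clear; lra.
pose bc j i := 2 * kap j * (a j i * x i) - 2 * lam R * disp a x j * a j i.
have [v [[v_neq0 v_off v_x v_B v_T] [P1 P2 P3]]] :=
  @direction_exists R _ _ V Q _ _ a x (fun j => kap j * mm j) D bc
    (fun j => mm j / u j) (fun i => 8 * beta * rho ^+ 2 * E i)
    (fun j i => a j i / u j ^+ 3) a01 x2 D0 km0 kmD h0 g0 trace
    (card_big_le V st) (card_tight_le st fs) V2.
have bE j : \sum_(l in V) bc j l * v l = 2 * kap j * (\sum_(i in V) a j i * x i * v i)
    - 2 * lam R * disp a x j * (\sum_(i in V) a j i * v i).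
  rewrite /bc; move: (2 * kap j) (2 * lam R * disp a x j) => p1 p2.
  by rewrite !mulr_sumr -sumrB; apply: eq_bigr => i _; ring.
exists v; split; first split => //.
- by move=> j jB; apply: v_B; rewrite inE.
- by move=> j jQ tight; apply: v_T; rewrite inE jQ; apply/eqP.
have fix_b (f : 'I_m -> R -> R) (S : {set 'I_m}) : \sum_(j in S) f j (\sum_(l in V) bc j l * v l) =
    \sum_(j in S) f j (2 * kap j * (\sum_(i in V) a j i * x i * v i)
    - 2 * lam R * disp a x j * (\sum_(i in V) a j i * v i)).
  by apply: eq_bigr => j _; rewrite bE.
have lam1 : lam R * 1000 * 1000 <= 1 by rewrite lamE.
have Qok j : j \in Q -> [/\ 0 < sg j, rho <= sg j ^+ 2, sg j <= 4 * rho,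
    rho * sg j / 18 <= u j & lam R * disp a x j ^+ 2 <= rho ^+ 2].
  move=> jQ; have [al0 u0 sg0 thr] := act j jQ.
  have := jQ; rewrite inE => /andP[r r16].
  have lamd := lam_disp_le st x1 al0 (ltW u0).
  have sg4 := sqrt_alive_le st r16.
  by split; rewrite ?sg2.
have P3' : \sum_(i in V) 8 * beta * rho ^+ 2 * E i * (\sum_(j in Q) a j i / u j ^+ 3 *
      (2 * kap j * (\sum_(i in V) a j i * x i * v i)
        - 2 * lam R * disp a x j * (\sum_(i in V) a j i * v i))) ^+ 2
    <= \sum_(j in Q) mm j / u j * (2 * kap j * (\sum_(i in V) a j i * x i * v i)
        - 2 * lam R * disp a x j * (\sum_(i in V) a j i * v i)) ^+ 2.
  move: P3; rewrite (fix_b (fun j z => mm j / u j * z ^+ 2)).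
  suff -> : \sum_(i in V) 8 * beta * rho ^+ 2 * E i *
        (\sum_(j in Q) a j i / u j ^+ 3 * \sum_(l in V) bc j l * v l) ^+ 2
      = \sum_(i in V) 8 * beta * rho ^+ 2 * E i * (\sum_(j in Q) a j i / u j ^+ 3 *
      (2 * kap j * (\sum_(i in V) a j i * x i * v i)
        - 2 * lam R * disp a x j * (\sum_(i in V) a j i * v i))) ^+ 2 by [].
  apply: eq_bigr => i _.
  by rewrite (fix_b (fun j z => a j i / u j ^+ 3 * z)).
exact: (@second_order_bound R _ _ V Q a x v E u (disp a x) sg mm kap D _ _ rho (lam R) beta
  (lam_gt0 R) lam1 rho400 beta0 a0 (fun i _ => E0 i) v_neq0 v_off Qok
  (fun _ => erefl) (fun _ => erefl) (fun _ => erefl) (fun _ => erefl) (fun _ => erefl)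
  P1 P2 P3').
Qed.

Lemma elem_load_split (R : realType) n m (a : 'I_m -> 'I_n -> R) rho V x y i :
  elem_load a rho V y i =
    \sum_(j in ~: active a rho V) a j i * load a rho V x j +
    \sum_(j in active a rho V) a j i * (rho ^+ 2 * (slack a rho V y j ^+ 2)^-1).
Proof.
rewrite /elem_load (bigID (mem (active a rho V))) /= addrC; congr (_ + _).
  apply: eq_big => [j|j jQ]; first by rewrite !inE.
  by rewrite (load_inactive x y jQ).
by apply: eq_bigr => j jQ; rewrite load_active.
Qed.

(** Slacks are exactly quadratic along the line and loads of inactive rows are constant. As [v] is
    orthogonal to [x], the squared norm has no linear term. The value of [c1] is left open because
    [upper_jet_descent] accepts any. *)
Lemma upper_jet_potential (R : realType) n m (a : 'I_m -> 'I_n -> R) rho beta V x v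
    (Q := active a rho V) (u := slack a rho V x) (b q : 'I_m -> R)
    (w1 := fun i => - (2 * rho ^+ 2 * \sum_(j in Q) a j i / u j ^+ 3 * b j))
    (w2 := fun i => rho ^+ 2 * \sum_(j in Q)
      a j i * (4 * b j ^+ 2 / u j ^+ 4 - 2 * q j / u j ^+ 3))
    (E := fun i => expR (beta * elem_load a rho V x i)) :
  (forall j i, 0 <= a j i) -> 0 <= beta ->
  (forall j, j \in Q -> 0 < u j) ->
  (forall t j, slack a rho V (fun i => x i + t * v i) j = u j + b j * t + q j * t ^+ 2) ->
  (forall i, i \notin V -> v i = 0) -> \sum_(i in V) x i * v i = 0 ->
  exists c1, upper_jet (fun t => potential a rho beta V (fun i => x i + t * v i))
    (potential a rho beta V x) c1
    (\sum_(i in V) E i * (beta * w2 i + 2 * beta ^+ 2 * w1 i ^+ 2)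
      - \sum_(i in V) v i ^+ 2).
Proof.
move=> a0 beta0 u0 line v_off v_x.
have jet_load i : upper_jet (fun t => elem_load a rho V (fun i => x i + t * v i) i)
    (elem_load a rho V x i) (w1 i) (w2 i).
  pose f t := \sum_(j in Q) a j i * (rho ^+ 2 * ((u j + b j * t + q j * t ^+ 2) ^+ 2)^-1).
  have jf : upper_jet f
      (\sum_(j in Q) a j i * (rho ^+ 2 * (u j ^+ 2)^-1))
      (\sum_(j in Q) a j i * (rho ^+ 2 * - (2 * b j / u j ^+ 3)))
      (\sum_(j in Q) a j i * (rho ^+ 2 * (4 * b j ^+ 2 / u j ^+ 4 - 2 * q j / u j ^+ 3))).
    apply: upper_jet_sum => j jQ; apply: upper_jetZ => //; apply: upper_jetZ.
      exact: sqr_ge0.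
    exact: upper_jet_invsq (u0 j jQ).
  pose c := \sum_(j in ~: Q) a j i * load a rho V x j.
  have := upper_jetD (upper_jet_poly c 0 0) jf.
  have -> : c + \sum_(j in Q) a j i * (rho ^+ 2 * (u j ^+ 2)^-1) = elem_load a rho V x i.
    by rewrite [RHS](elem_load_split a rho V x).
  have -> : 0 + \sum_(j in Q) a j i * (rho ^+ 2 * - (2 * b j / u j ^+ 3)) = w1 i.
    rewrite add0r /w1 mulr_sumr -sumrN; apply: eq_bigr => j _; ring.
  have -> : 0 + \sum_(j in Q) a j i *
      (rho ^+ 2 * (4 * b j ^+ 2 / u j ^+ 4 - 2 * q j / u j ^+ 3)) = w2 i.
    by rewrite add0r /w2 mulr_sumr; apply: eq_bigr => j _; exact: mulrCA.
  apply: upper_jet_ext => t; rewrite (elem_load_split a rho V x) -/c !mul0r !addr0.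
  by congr (_ + _); apply: eq_bigr => j _; rewrite line.
have jet_exp := upper_jet_sum (fun i (_ : i \in V) => upper_jet_expR beta0 (jet_load i)).
have norm_line t : - \sum_i (x i + t * v i) ^+ 2
    = - (\sum_i x i ^+ 2) + 0 * t + (- \sum_(i in V) v i ^+ 2) * t ^+ 2.
  have onV (f : 'I_n -> R) : (forall i, i \notin V -> f i = 0) ->
      \sum_i f i = \sum_(i in V) f i.
    by move=> f0; rewrite (bigID (mem V)) /= [X in _ + X]big1 ?addr0.
  rewrite -[\sum_(i in V) v i ^+ 2]onV; last by move=> i /v_off ->; rewrite expr0n.
  have xv : \sum_i x i * v i = 0.
    by rewrite onV// => i /v_off ->; rewrite mulr0.
  transitivity (- (\sum_i x i ^+ 2 + 2 * t * \sum_i x i * v i + t ^+ 2 * \sum_i v i ^+ 2)).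
    congr (- _); rewrite !mulr_sumr -!big_split; apply: eq_bigr => i _ /=; ring.
  by rewrite xv; ring.
have := upper_jetD jet_exp (upper_jet_ext norm_line (upper_jet_poly _ _ _)).
by move=> jet; eexists; exact: jet.
Qed.

(** Strict conditions survive a short move and the others are preserved by the constraints on [v];
    orthogonality to [x] makes the norm grow for either sign of [t]. *)
Lemma interior_improve (R : realType) n m (a : 'I_m -> 'I_n -> R) rho beta V x :
  setting a rho beta -> feasible a rho beta V x -> (2 <= #|V|)%N ->
  (forall i, i \in V -> `|x i| < 1) ->
  exists y : 'I_n -> R, [/\ feasible a rho beta V y,
    forall i, i \notin V -> y i = x i & \sum_i x i ^+ 2 < \sum_i y i ^+ 2].
Proof.
move=> st fs V2 xlt1; have [a0 _ _ rho0] := setting_a st.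
have [_ _ _ [beta0 _] _] := st.
have [[x1 xoff] big act small pot] := fs.
have [v [[v_neq0 v_off v_x v_B v_T] c_lt]] := feasible_direction st fs V2.
set Q := active a rho V in v_T c_lt.
set u := slack a rho V x in v_T c_lt *.
set sg := fun j => Num.sqrt (alive a V j) in v_T c_lt *.
pose kap j := rho / (16 * sg j).
pose al j := \sum_(i in V) a j i * v i.
pose xi j := \sum_(i in V) a j i * x i * v i.
pose b j := 2 * kap j * xi j - 2 * lam R * disp a x j * al j.
pose q j := kap j * (\sum_(i in V) a j i * v i ^+ 2) - lam R * al j ^+ 2.
pose y t i := x i + t * v i.
have line t j : slack a rho V (y t) j = u j + b j * t + q j * t ^+ 2.
  exact: slack_line v_off.
have u0 j : j \in Q -> 0 < u j by case/(feasible_slack st fs).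
have [c1 jet] := @upper_jet_potential R n m a rho beta V x v b q a0 (ltW beta0) u0
  line v_off v_x.
have jet_neg : _ < 0 := etrans (subr_lt0 _ _) c_lt.
pose P (k : 'I_n + 'I_m) t := match k with
  | inl i => i \in V -> `|y t i| <= 1
  | inr j => j \in Q -> rho * sg j / 18 <= slack a rho V (y t) j end.
have [|tau [tau0 stay]] := @common_radius R _ P.
  case=> [i|j] /=.
    case: (boolP (i \in V)) => iV; last by exists 1.
    have A0 : 0 < 1 - x i ^+ 2.
      by rewrite subr_gt0 -[x i ^+ 2]real_normK ?num_real// expr_lt1 ?xlt1.
    have [tau [tau0 h]] := quadratic_ge0_near (- (2 * x i * v i)) (- v i ^+ 2) A0.
    exists tau; split=> // t /h h' _.
    rewrite -(@ler_pXn2r _ 2) ?nnegrE// real_normK ?num_real// expr1n -subr_ge0.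
    apply: le_trans h' _; rewrite /y le_eqVlt; apply/orP; left; apply/eqP; ring.
  case: (boolP (j \in Q)) => jQ; last by exists 1.
  (* On a tight row both the discrepancy and the linear part of [mass] are constant, so the slack
     can only increase. *)
  have [uE|u_neq] := eqVneq (u j) (rho * sg j / 18).
    exists 1; split=> // t _ _; rewrite line -uE.
    have [al0 xi0] := v_T j jQ uE.
    rewrite /b /q /al /xi al0 xi0 expr0n !mulr0 subrr mul0r addr0 subr0 lerDl.
    rewrite mulr_ge0 ?sqr_ge0// mulr_ge0 ?divr_ge0 ?mulr_ge0 ?sqrtr_ge0 ?(ltW rho0)//.
    by apply: sumr_ge0 => i _; rewrite mulr_ge0 ?sqr_ge0.
  have A0 : 0 < u j - rho * sg j / 18.
    by rewrite subr_gt0 lt_neqAle eq_sym u_neq act.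
  have [tau [tau0 h]] := quadratic_ge0_near (b j) (q j) A0.
  exists tau; split=> // t /h h' _; rewrite line -subr_ge0.
  apply: le_trans h' _; move: (rho * sg j / 18) (u j) (b j) (q j) => p1 p2 p3 p4.
  by rewrite le_eqVlt; apply/orP; left; apply/eqP; ring.
have [t [t_neq0 t_tau pot_t]] := upper_jet_descent jet jet_neg tau0.
have yoff i : i \notin V -> y t i = x i by move=> /v_off; rewrite /y => ->; rewrite mulr0 addr0.
exists (y t); split=> //.
  split.
  - split=> i; last by move=> iV; rewrite yoff ?xoff.
    case: (boolP (i \in V)) => [|/yoff -> //]; exact: (stay (inl i) t t_tau).
  - by move=> j jB; rewrite (disp_line a x t j v_off) (big j jB) (v_B j jB) mulr0 addr0.
  - by move=> j jQ; exact: (stay (inr j) t t_tau jQ).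
  - move=> j js.
    have -> : \sum_(i in ~: V) a j i * y t i = \sum_(i in ~: V) a j i * x i.
      by apply: eq_bigr => i; rewrite inE => /yoff ->.
    exact: small.
  - exact: le_trans pot_t pot.
have norm_y : \sum_i y t i ^+ 2 = \sum_i x i ^+ 2 + t ^+ 2 * \sum_i v i ^+ 2.
  have xv : \sum_i x i * v i = 0.
    by rewrite (bigID (mem V)) /= [X in _ + X]big1 ?addr0// => i /v_off ->; rewrite mulr0.
  transitivity (\sum_i x i ^+ 2 + 2 * t * \sum_i x i * v i + t ^+ 2 * \sum_i v i ^+ 2).
    rewrite !mulr_sumr -!big_split; apply: eq_bigr => i _ /=; rewrite /y; ring.
  by rewrite xv mulr0 addr0.
rewrite norm_y ltrDl mulr_gt0 ?exprn_even_gt0//.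
case: v_neq0 => i0 vi0; rewrite (bigD1 i0)//= ltr_pwDl ?exprn_even_gt0//.
by apply: sumr_ge0 => i _; exact: sqr_ge0.
Qed.

(** * Compactness: feasible points of maximal norm *)

Lemma continuous_sum (R : realType) (T : topologicalType) (I : finType) (P : pred I)
    (f : I -> T -> R) :
  (forall i, P i -> continuous (f i)) -> continuous (fun X => \sum_(i | P i) f i X).
Proof. by move=> fc X; apply: cvg_big => [|i /fc]; [exact: add_continuous | exact]. Qed.

Lemma continuous_add (R : realType) (T : topologicalType) (f g : T -> R) :
  continuous f -> continuous g -> continuous (fun X => f X + g X).
Proof. by move=> fc gc X; apply: cvgD; [exact: fc | exact: gc]. Qed.

Lemma continuous_scale (R : realType) (T : topologicalType) (k : R) (f : T -> R) :
  continuous f -> continuous (fun X => k * f X).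
Proof. by move=> fc X; apply: cvgM; [exact: cvg_cst | exact: fc]. Qed.

Lemma continuous_sq (R : realType) (T : topologicalType) (f : T -> R) :
  continuous f -> continuous (fun X => f X ^+ 2).
Proof. by move=> fc X; apply: cvgM; exact: fc. Qed.

Lemma continuous_const (R : realType) (T : topologicalType) (k : R) :
  continuous (fun _ : T => k).
Proof. by move=> X; exact: cvg_cst. Qed.

Lemma argmax_sqnorm (R : realType) (n : nat) (K : Type) (F : K -> 'rV[R]_n -> R)
    (X0 : 'rV[R]_n) :
  (forall k, continuous (F k)) ->
  (forall i, `|X0 0 i| <= 1) -> (forall k, 0 <= F k X0) ->
  exists X : 'rV[R]_n, [/\ forall i, `|X 0 i| <= 1, forall k, 0 <= F k X &
    forall Y : 'rV[R]_n, (forall i, `|Y 0 i| <= 1) -> (forall k, 0 <= F k Y) ->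
      \sum_i Y 0 i ^+ 2 <= \sum_i X 0 i ^+ 2].
Proof.
move=> Fc X01 FX0.
pose cube := [set X : 'rV[R]_n | forall i, `[(-1 : R), 1]%classic (X ord0 i)]%classic.
pose S := (cube `&` \bigcap_(k in setT) (F k @^-1` [set z | 0 <= z]))%classic.
have cS : compact S.
  apply: compact_closedI.
    by apply: (@rV_compact R n (fun=> `[(-1 : R), 1]%classic)) => _; exact: segment_compact.
  apply: closed_bigI => k _; apply: preimage_closed; last exact: closed_ge.
  by move=> X _; exact: Fc.
have inS (X : 'rV[R]_n) : (forall i, `|X 0 i| <= 1) -> (forall k, 0 <= F k X) -> S X.
  by move=> X1 FX; split=> [i|k _]; [rewrite /= in_itv /= -ler_norml; exact: X1|exact: FX].
have S0 : (S !=set0)%classic by exists X0; exact: inS.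
have sq_cont : {within S, continuous (fun X : 'rV[R]_n => \sum_i X 0 i ^+ 2)}%classic.
  apply: continuous_subspaceT; apply: continuous_sum => i _.
  by apply: continuous_sq; exact: coord_continuous.
have [X] := compact_EVT_max S0 cS sq_cont.
rewrite inE => -[X1 FX] Xmax; exists X; split.
- by move=> i; have := X1 i; rewrite /= in_itv /= -ler_norml.
- by move=> k; exact: FX.
- by move=> Y Y1 FY; apply: Xmax; rewrite inE; exact: inS.
Qed.

(** Only the coordinates in [V] vary, so the condition on small rows is inherited from [x]; the
    remaining ones are closed conditions on the cube. *)
Lemma feasible_argmax (R : realType) n m (a : 'I_m -> 'I_n -> R) rho beta V x :
  setting a rho beta -> feasible a rho beta V x ->
  exists y : 'I_n -> R, feasible a rho beta V y /\
    forall z : 'I_n -> R, feasible a rho beta V z ->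
      (forall i, i \notin V -> z i = y i) -> \sum_i z i ^+ 2 <= \sum_i y i ^+ 2.
Proof.
move=> st fs; have [_ _ _ rho0] := setting_a st.
have [[x1 xoff] big act small pot] := fs.
set Q := active a rho V in act.
pose vec (X : 'rV[R]_n) := fun i => X 0 i.
pose thr j := rho * Num.sqrt (alive a V j) / 18.
have thr0 j : j \in Q -> 0 < thr j.
  by move=> jQ; have [al0 _ _] := feasible_slack st fs jQ;
    rewrite divr_gt0 ?mulr_gt0 ?sqrtr_gt0.
(* Truncating [slack] from below makes the potential continuous everywhere. *)
pose cpot (X : 'rV[R]_n) := \sum_(i in V) expR (beta *
    (\sum_(j in ~: Q) a j i * load a rho V x j +
     \sum_(j in Q) a j i * (rho ^+ 2 *
       (Num.max (slack a rho V (vec X) j) (thr j) ^+ 2)^-1)))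
  - \sum_i X 0 i ^+ 2.
have cpotE X : (forall j, j \in Q -> thr j <= slack a rho V (vec X) j) ->
    cpot X = potential a rho beta V (vec X).
  move=> Xact; congr (_ - _); apply: eq_bigr => i _.
  rewrite (elem_load_split a rho V x); congr (expR (_ * (_ + _))).
  by apply: eq_bigr => j jQ; rewrite max_l ?Xact.
(* Each condition becomes the nonnegativity of a continuous function, an equality being the
   nonnegativity of minus a square. *)
pose F (k : 'I_n + ('I_m + ('I_m + unit))) : 'rV[R]_n -> R := match k with
  | inl i => if i \in V then fun=> 0 else fun X => - (X 0 i - x i) ^+ 2
  | inr (inl j) => if 16 * rho ^+ 2 < alive a V j
      then fun X => - disp a (vec X) j ^+ 2 else fun=> 0
  | inr (inr (inl j)) => if j \in Q
      then fun X => slack a rho V (vec X) j - thr j else fun=> 0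
  | inr (inr (inr _)) => fun X => n%:R * expR (4 * beta) - cpot X end.
have coordc (i : 'I_n) : continuous (fun X : 'rV[R]_n => X 0 i) := @coord_continuous R 1 n 0 i.
have dispc j : continuous (fun X : 'rV[R]_n => disp a (vec X) j).
  by apply: continuous_sum => i _; apply: continuous_scale; exact: coordc.
have oppc (f : 'rV[R]_n -> R) : continuous f -> continuous (fun X => - f X).
  move=> fc; have -> : (fun X => - f X) = (fun X => -1 * f X).
    by apply/funext => X; rewrite mulN1r.
  exact: continuous_scale.
have slackc j : continuous (fun X : 'rV[R]_n => slack a rho V (vec X) j).
  apply: continuous_add.
    apply: continuous_add; last exact: continuous_const.
    apply: continuous_add; first exact: continuous_const.
    by apply: oppc; apply: continuous_scale; apply: continuous_sq; exact: dispc.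
  apply: continuous_scale; apply: continuous_sum => i _.
  by apply: continuous_scale; apply: continuous_sq; exact: coordc.
have cpotc : continuous cpot.
  apply: continuous_add; last first.
    by apply: oppc; apply: continuous_sum => i _; apply: continuous_sq; exact: coordc.
  apply: continuous_sum => i iV X; apply: continuous_comp; last exact: continuous_expR.
  move: X; apply: continuous_scale; apply: continuous_add; first exact: continuous_const.
  apply: continuous_sum => j jQ; apply: continuous_scale; apply: continuous_scale => X.
  apply: (@continuousV R _
    (fun X => Num.max (slack a rho V (vec X) j) (thr j) ^+ 2) X).
    by rewrite expf_neq0// gt_eqF// lt_max thr0// orbT.
  move: X; apply: continuous_sq => X.
  apply: (@continuous_max R _ (fun X => slack a rho V (vec X) j) (fun=> thr j) X).
    exact: slackc.
  exact: continuous_const.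
have Fc k : continuous (F k).
  case: k => [i|[j|[j|[]]]] /=.
  - case: (i \in V); first exact: continuous_const.
    apply: oppc; apply: continuous_sq; apply: continuous_add => //.
    exact: continuous_const.
  - case: (16 * rho ^+ 2 < alive a V j); last exact: continuous_const.
    by apply: oppc; apply: continuous_sq; exact: dispc.
  - case: (j \in Q); last exact: continuous_const.
    by apply: continuous_add => //; exact: continuous_const.
  - by apply: continuous_add; [exact: continuous_const | exact: oppc].
have toF z (Z := \row_i z i) : feasible a rho beta V z ->
    (forall i, i \notin V -> z i = x i) -> forall k, 0 <= F k Z.
  move=> [[z1 zoff] zbig zact zsmall zpot] zx.
  have vZ : vec Z = z by apply/funext => i; rewrite /vec mxE.
  case=> [i|[j|[j|[]]]] /=.
  - by case: ifPn => //= iV; rewrite mxE zx// subrr expr0n oppr0.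
  - by case: ifPn => //= jB; rewrite vZ zbig// expr0n oppr0.
  - by case: ifPn => //= jQ; rewrite vZ subr_ge0; exact: zact.
  - by rewrite subr_ge0 cpotE vZ.
have [||X [X1 FX Xmax]] := @argmax_sqnorm R n _ F (\row_i x i) Fc.
- by move=> i; rewrite mxE.
- exact: toF.
have Xx i : i \notin V -> vec X i = x i.
  move=> /negbTE iV; have := FX (inl i); rewrite /= iV /= oppr_ge0 => h.
  have := le_anti (introT andP (conj h (sqr_ge0 _))); move=> /eqP.
  by rewrite sqrf_eq0 subr_eq0 => /eqP.
have Xact j : j \in Q -> thr j <= slack a rho V (vec X) j.
  by move=> jQ; have := FX (inr (inr (inl j))); rewrite /= jQ /= subr_ge0.
exists (vec X); split.
  split.
  - by split => // i iV; rewrite Xx ?xoff.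
  - move=> j jB; have := FX (inr (inl j)); rewrite /= jB /= oppr_ge0 => h.
    have := le_anti (introT andP (conj h (sqr_ge0 _))); move=> /eqP.
    by rewrite sqrf_eq0 => /eqP.
  - exact: Xact.
  - move=> j js.
    have -> : \sum_(i in ~: V) a j i * vec X i = \sum_(i in ~: V) a j i * x i.
      by apply: eq_bigr => i; rewrite inE => /Xx ->.
    exact: small.
  - by have := FX (inr (inr (inr tt))); rewrite /= subr_ge0 cpotE.
move=> z zfs zX; have := Xmax (\row_i z i).
have -> : \sum_i (\row_i z i) 0 i ^+ 2 = \sum_i z i ^+ 2.
  by apply: eq_bigr => i _; rewrite mxE.
apply; last by apply: toF => // i iV; rewrite zX ?Xx.
by move=> i; rewrite mxE; case: zfs => -[].
Qed.

(** * Rounding to signs and the discrepancy bound *)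

(** Induction on the number of alive elements: a maximizer with at least two of them and none at
    absolute value 1 would contradict [interior_improve]. The process stops at one because the
    dimension count needs two. *)
Lemma rounding (R : realType) n m (a : 'I_m -> 'I_n -> R) rho beta :
  setting a rho beta ->
  exists V x, feasible a rho beta V x /\ (#|V| <= 1)%N.
Proof.
move=> st.
suff shrink k : forall (V : {set 'I_n}) x, (#|V| <= k)%N -> feasible a rho beta V x ->
    exists V x, feasible a rho beta V x /\ (#|V| <= 1)%N.
  exact: shrink (leqnn _) (feasible_start st).
elim: k => [|k IH] V x Vk fs; first by exists V, x; split=> //; exact: leq_trans Vk _.
have [V1|V2] := leqP #|V| 1; first by exists V, x.
have [y [yfs ymax]] := feasible_argmax st fs.
have [/forall_inP int|] := boolP [forall i in V, `|y i| < 1].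
  have [z [zfs zy lt_yz]] := interior_improve st yfs V2 int.
  by have := ymax z zfs zy; rewrite leNgt lt_yz.
rewrite negb_forall_in => /exists_inP[i0 i0V]; rewrite -leNgt => y_i0.
have [[y1 _] _ _ _ _] := yfs.
pose V' := [set i in V | `|y i| != 1].
have V'V : V' \subset V by apply/fintype.subsetP => i; rewrite inE => /andP[].
apply: (IH V' y); last first.
  apply: feasible_shrink st V'V _ yfs => i iV; rewrite inE iV /= negbK.
  by move=> /eqP.
rewrite -ltnS; apply: leq_trans Vk; apply: proper_card; apply/properP; split=> //.
by exists i0 => //; rewrite inE i0V /= negbK eq_le y1 y_i0.
Qed.

(** With at most one alive element every row is small, so the fourth condition covers all rows, and
    its [alive] term pays for the last coordinate. *)
Lemma small_disp_signs (R : realType) n m (a : 'I_m -> 'I_n -> R) rho beta :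
  setting a rho beta -> exists s : {ffun 'I_n -> bool},
    forall j, `|\sum_i a j i * (-1) ^+ s i| <= 1002 * rho.
Proof.
move=> st; have [a0 a1 _ rho0] := setting_a st.
have [_ _ rho400 _ _] := st.
have [V [x [[[x1 xoff] _ _ small _] V1]]] := rounding st.
exists [ffun i => x i < 0] => j.
have alive1 : alive a V j <= 1.
  apply: (@le_trans _ _ #|V|%:R); last by rewrite lern1.
  by rewrite -sum1_card natr_sum; apply: ler_sum.
have alive_rho : alive a V j < rho.
  by apply: le_lt_trans alive1 _; move: rho400; clear; lra.
apply: le_trans (small j alive_rho).
rewrite (bigID (mem V)) /= addrC; apply: (le_trans (ler_normD _ _)).
apply: lerD; last first.
  apply: (le_trans (ler_norm_sum _ _ _)); apply: ler_sum => i _.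
  by rewrite normrM normr_sign mulr1 ger0_norm.
rewrite le_eqVlt; apply/orP; left; apply/eqP; congr (`|_|).
apply: eq_big => [i|i iV]; first by rewrite inE.
rewrite ffunE; congr (_ * _); have := xoff i iV.
case: ltP => xi; first by rewrite ltr0_norm// expr1 => <-; rewrite opprK.
by rewrite ger0_norm// expr0.
Qed.

Lemma disc_le (R : realType) m n (A : 'M[R]_(m, n)) (s : {ffun 'I_n -> bool}) (B : R) :
  0 <= B -> (forall j, `|\sum_i A j i * (-1) ^+ s i| <= B) -> disc A <= B.
Proof.
move=> B0 AB; apply: le_trans (bigmin_le_cond _ _ (isT : xpredT s)) _.
rewrite [leLHS]/Num.Def.normr /= mx_normrE; apply/bigmax_leP; split=> // -[j l] _ /=.
rewrite mxE; have := AB j; congr (`|_| <= _); apply: eq_bigr => i _.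
by rewrite mxE.
Qed.

Theorem theorem1p3 (R : realType) :
  forall c : R, 0 < c ->
  exists C : R, 0 < C /\
    forall (m n k : nat) (A : 'M[R]_(m, n)),
      zero_one A ->
      column_sparse k A ->
      c * ln n%:R ^+ 2 <= k%:R ->
      disc A <= C * Num.sqrt k%:R.
Proof.
move=> c c0; set sc := Num.sqrt c.
have sc0 : 0 < sc by rewrite sqrtr_gt0.
(* The first summand gives [rho >= 400], as [k >= 1]; the second gives [rho >= 256 * ln n]. Together
   they bound [512 * beta = 128 * ln (2 n)]. *)
set K := 400 + 256 / sc.
have K256 : 0 < 256 / sc by apply: divr_gt0 sc0; lra.
have K0 : 0 < K by rewrite /K; move: K256; set z := 256 / sc; clear; lra.
exists (1002 * K); split; first by move: K0; clear; lra.
move=> m n k A A01 Ak kn.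
set rk := Num.sqrt k%:R; rewrite -mulrA.
have rk0 : 0 <= rk by exact: sqrtr_ge0.
have B0 : 0 <= 1002 * (K * rk).
  by move: (mulr_ge0 (ltW K0) rk0); set z := K * rk; clear; lra.
have col i : \sum_j A j i <= k%:R.
  apply: (@le_trans _ _ (#|[pred j : 'I_m | A j i != 0]|%:R)); last by rewrite ler_nat.
  rewrite -sum1_card natr_sum big_mkcond /= [leRHS]big_mkcond /=; apply: ler_sum => j _.
  by rewrite inE; case: (A01 j i) => ->; rewrite ?eqxx// oner_neq0.
have A0 j i : 0 <= A j i by case: (A01 j i) => ->.
(* The cases [n = 0], where no [beta] satisfies the setting, and [k = 0], where [rho] would vanish,
   are settled apart: every row sum is 0. *)
have [n0|n_gt0] := posnP n.
  apply: (@disc_le _ _ _ _ [ffun => false]) => // j.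
  by rewrite big1 ?normr0// => i _; move: (ltn_ord i); rewrite [X in (_ < X)%N]n0.
have [k0|k_gt0] := posnP k.
  apply: (@disc_le _ _ _ _ [ffun => false]) => // j.
  rewrite big1 ?normr0// => i _; suff -> : A j i = 0 by rewrite mul0r.
  apply/eqP; rewrite eq_le A0 andbT; apply: le_trans (_ : \sum_j A j i <= 0).
    by rewrite (bigD1 j)//= lerDl; apply: sumr_ge0.
  by apply: le_trans (col i) _; rewrite k0.
have rk1 : 1 <= rk by rewrite -sqrtr1 ler_sqrt ?ler1n.
have rk2 : rk ^+ 2 = k%:R by rewrite sqr_sqrtr.
have n1 : 1 <= n%:R :> R by rewrite ler1n.
have n0 : 0 < n%:R :> R by rewrite ltr0n.
have ln_rk : sc * ln n%:R <= rk.
  rewrite -(@ler_pXn2r _ 2) ?nnegrE ?mulr_ge0 ?ln_ge0 ?(ltW sc0)//.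
  by rewrite exprMn rk2 sqr_sqrtr ?(ltW c0).
set rho := K * rk; pose beta := ln (2 * n%:R) / 4 : R.
have ln2n : ln (2 * n%:R) = ln 2 + ln n%:R :> R by rewrite lnM ?posrE.
have ln2 : ln 2 <= 1 :> R.
  have -> : 2 = 1 + 1 :> R by [].
  by apply: le_ln1Dx; rewrite (@lt_trans _ _ 0) ?ltrN10 ?ltr01.
have rho400 : 400 <= rho /\ 256 * ln n%:R <= rho.
  have rhoE : rho = 400 * rk + 256 / sc * rk by exact: mulrDl.
  have e : 256 * ln n%:R = 256 / sc * (sc * ln n%:R) by field; rewrite gt_eqF.
  have z0 : 0 <= 256 / sc * rk by rewrite mulr_ge0 ?(ltW K256).
  move: (ler_wpM2l (ltW K256) ln_rk) z0 rk1; rewrite -e rhoE.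
  set z := 256 / sc * rk; set w := ln _; clear.
  by move=> h1 h2 h3; split; lra.
have st : setting A rho beta.
  split => //.
  - move=> i; apply: (le_trans (col i)); rewrite /rho exprMn rk2 ler_peMl//.
    rewrite expr_ge1 ?(ltW K0)// /K; move: K256; set z := 256 / sc; clear; lra.
  - by case: rho400.
  - have ln2_gt0 : 0 < ln 2 :> R by apply: ln_gt0; rewrite ltr1n.
    have lnn : 0 <= ln n%:R :> R by apply: ln_ge0.
    rewrite /beta ln2n; move: ln2_gt0 lnn ln2 rho400.
    set z := ln 2; set w := ln _; clear => h1 h2 h3 [h4 h5]; split; lra.
  - have -> : 4 * beta = ln (2 * n%:R) by rewrite /beta; field.
    by rewrite lnK// posrE mulr_gt0.
have [s sP] := small_disp_signs st.
exact: disc_le B0 sP.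
Qed.
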